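(* Let $f_1,f_2 \in \mathbb{C}[x_1,x_2]$ and let $u := -e_2\in\mathbb{R}^2$. Assume that $f_1^u$ and $f_2^u$ have a non-zero constant term and that $m := \deg\gcd(f_1^u,f_2^u) > 0$. Then there exists a lifting $(\tilde f_1,\tilde f_2,g)$ of $(f_1,f_2)$ with $\tilde f_1,\tilde f_2,g \in \mathbb{C}[x_1,x_2,y]$, given explicitly by $$\tilde f_1 = y\,q_1 + r_1 + (f_1-f_1^u),\qquad \tilde f_2 = y\,q_2 + r_2 + (f_2-f_2^u),\qquad g = y-\gcd(f_1^u,f_2^u),$$ where $q_j$ and $r_j$ are the quotient and remainder of the division of $f_j^u$ by $\gcd(f_1^u,f_2^u)$ (so $r_1=r_2=0$), satisfying $$\mathrm{MV}(\mathrm{N}(\tilde f_1),\mathrm{N}(\tilde f_2),\mathrm{N}(g)) \le \mathrm{MV}(\mathrm{N}(f_1),\mathrm{N}(f_2)) - m.$$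
   Context: Notation: $\mathbb{C}^*=\mathbb{C}\setminus\{0\}$, and $e_2=(0,1)$ is the second standard basis vector of $\mathbb{R}^2$. Newton polytopes and facial polynomials: the support $\mathrm{supp}(f)$ of a polynomial $f$ is the set of exponent vectors $a$ such that $x^a$ has nonzero coefficient in $f$, and $\mathrm{N}(f)=\mathrm{conv}(\mathrm{supp}(f))$ is its Newton polytope. For a polytope $P\subset\mathbb{R}^2$ and $u\in\mathbb{R}^2\setminus\{0\}$, $P^u$ is the face of $P$ on which $\langle\cdot,u\rangle$ is maximal; $f^u$ is the polynomial consisting of those terms of $f$ supported on $\mathrm{N}(f)^u$. (Since $f_i^u$ has a nonzero constant term and $u=-e_2$, $f_i^u$ consists of the terms of $f_i$ not involving $x_2$, so $f_1^u,f_2^u$ are univariate polynomials in $x_1$, and the gcd, its degree and the division are taken in $\mathbb{C}[x_1]$.) Mixed volume: $\mathrm{Vol}$ is the normalized volume in $\mathbb{R}^n$ ($n!$ times Euclidean volume), and $\mathrm{MV}$ of $n$-tuples of lattice polytopes in $\mathbb{R}^n$ is the unique (symmetric) functional such that $\mathrm{Vol}(\lambda_1P_1+\dots+\lambda_lP_l)=\sum_{i_1=1}^l\cdots\sum_{i_n=1}^l\lambda_{i_1}\cdots\lambda_{i_n}\mathrm{MV}(P_{i_1},\dots,P_{i_n})$ for all lattice polytopes $P_1,\dots,P_l\subset\mathbb{R}^n$, all $\lambda_i\ge0$ and all $l\ge1$. On the left-hand side of the claimed inequality $n=3$ (variables $x_1,x_2,y$), on the right-hand side $n=2$. Lifting: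 $(\tilde f_1,\tilde f_2,g)$ with entries in $\mathbb{C}[x_1^{\pm1},x_2^{\pm1},y]$ is a lifting of $(f_1,f_2)$ if a point $(\alpha_1,\alpha_2)\in(\mathbb{C}^* )^2$ is a solution of $f_1=f_2=0$ if and only if there exists $\beta\in\mathbb{C}$ such that $(\alpha_1,\alpha_2,\beta)$ is a solution of $\tilde f_1=\tilde f_2=g=0$.
   Formalization: The mixed volume inequality is asserted only when f_1 and f_2 are not both in C[x_1] (not both f_1 = f_1^u and f_2 = f_2^u); otherwise it always fails, e.g. f_1 = f_2 = 1 + x_1 gives 0 ≤ -1. *)

(* Defs.v *)
From HB Require Import structures.
From mathcomp Require Import all_boot all_order all_algebra fingroup perm.
From mathcomp Require Import complex mpoly.
From mathcomp Require Import boolp classical_sets reals ereal convex.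
From mathcomp Require Import measure lebesgue_measure lebesgue_integral.

Set Implicit Arguments.
Unset Strict Implicit.
Unset Printing Implicit Defensive.

Import Order.TTheory GRing.Theory Num.Theory.
Local Open Scope classical_set_scope.
Local Open Scope ring_scope.

(* Polytopes are sets of row vectors.  The empty set is not a polytope:
   otherwise no mixed volume could exist, since 0 *: set0 = set0 would
   annihilate every Minkowski sum. *)

Section Polytopes.
Variables (R : realType) (n : nat).
Implicit Types (A P : set 'rV[R]_n) (u : 'rV[R]_n).

Definition convex_hull A : set 'rV[R]_n := smallest (@convex_set R 'rV[R]_n) A.

Definition lattice_polytope P :=
  exists2 s : seq 'rV[int]_n,
    s != [::] & P = convex_hull [set map_mx (intmul 1) v | v in [set` s]].

Definition dotv (x u : 'rV[R]_n) : R := \sum_(i < n) x 0 i * u 0 i.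

Definition face P u : set 'rV[R]_n :=
  [set x | P x /\ forall y, P y -> dotv y u <= dotv x u].

Definition minkowski_comb (l : nat) (lam : 'I_l -> R)
    (P : 'I_l -> set 'rV[R]_n) : set 'rV[R]_n :=
  [set x | exists2 v : 'I_l -> 'rV[R]_n,
     forall i, P i (v i) & x = \sum_(i < l) lam i *: v i].

(* The characterization of the mixed volume associated with a normalized
   volume vol.  On lattice polytopes it determines MV uniquely; the values of
   MV on other sets are irrelevant. *)
Definition is_mixed_volume (vol : set 'rV[R]_n -> \bar R)
    (MV : n.-tuple (set 'rV[R]_n) -> R) :=
  (forall (P : n.-tuple (set 'rV[R]_n)) (s : {perm 'I_n}),
     (forall k, lattice_polytope (tnth P k)) ->
     MV [tuple tnth P (s k) | k < n] = MV P)
  /\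
  (forall (l : nat) (P : 'I_l -> set 'rV[R]_n) (lam : 'I_l -> R),
     (0 < l)%N ->
     (forall i, lattice_polytope (P i)) ->
     (forall i, 0 <= lam i) ->
     vol (minkowski_comb lam P) =
     (\sum_(i : {ffun 'I_n -> 'I_l})
        (\prod_(k < n) lam (i k)) * MV [tuple P (i k) | k < n])%:E).

End Polytopes.

Section Volumes.
Variable R : realType.
Local Notation mu := (@lebesgue_measure R).

Definition normalized_vol2 (A : set 'rV[R]_2) : \bar R :=
  ((2`!)%:R%:E *
   (mu \x mu) [set p : R * R | A (\row_i tnth [tuple p.1; p.2] i)])%E.

Definition normalized_vol3 (A : set 'rV[R]_3) : \bar R :=
  ((3`!)%:R%:E *
   ((mu \x mu) \x mu)
     [set p : (R * R) * R | A (\row_i tnth [tuple p.1.1; p.1.2; p.2] i)])%E.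

End Volumes.

Section NewtonPolytopes.
Variables (R : realType) (n : nat).
Implicit Types (f : {mpoly (complex R)[n]}) (u : 'rV[R]_n).

Definition expv (a : 'X_{1..n}) : 'rV[R]_n := \row_i (a i)%:R.

Definition newton f : set 'rV[R]_n := convex_hull [set expv a | a in [set` msupp f]].

Definition facial u f : {mpoly (complex R)[n]} :=
  \sum_(a <- msupp f | `[< face (newton f) u (expv a) >]) f@_a *: 'X_[a].

End NewtonPolytopes.

Section Liftings.
Variable R : realType.
Local Notation C := (complex R).

(* In {mpoly C[2]} the variables 'X_0, 'X_1 are x_1, x_2; in {mpoly C[3]} the
   variables 'X_0, 'X_1, 'X_2 are x_1, x_2, y.  Correspondingly, the inclusion
   of C[x_1, x_2] into C[x_1, x_2, y] is mwiden. *)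

Definition e2 : 'rV[R]_2 := delta_mx 0 1.

(* Substitutes x_2 := 0; this is only used on polynomials not involving x_2,
   where it is the identification with an element of C[x_1]. *)
Definition univ_x1 (f : {mpoly C[2]}) : {poly C} :=
  mmap (@polyC C) (tnth [tuple 'X; 0]) f.

Definition embed_x1 (p : {poly C}) : {mpoly C[3]} :=
  (map_poly (@mpolyC 3 C) p).['X_0].

Definition is_lifting (f1 f2 : {mpoly C[2]}) (F1 F2 g : {mpoly C[3]}) :=
  forall a1 a2 : C, a1 != 0 -> a2 != 0 ->
    (f1.@[tnth [tuple a1; a2]] = 0 /\ f2.@[tnth [tuple a1; a2]] = 0)
    <->
    (exists b : C, [/\ F1.@[tnth [tuple a1; a2; b]] = 0,
                       F2.@[tnth [tuple a1; a2; b]] = 0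
                     & g.@[tnth [tuple a1; a2; b]] = 0]).

End Liftings.

(* Main.v *)
Require Import Defs.
From mathcomp Require Import all_boot all_order all_algebra fingroup perm.
From mathcomp Require Import complex mpoly.
From mathcomp Require Import boolp classical_sets functions set_interval reals ereal.
From mathcomp Require Import topology normedtype derive realfun convex.
From mathcomp Require Import measure measurable_realfun lebesgue_measure.
From mathcomp Require Import lebesgue_integral ftc.
From mathcomp Require Import ring lra.

(** Write [P_j], [Q] and [N_j] for the Newton polytopes of the lifted polynomial
    [F_j], of [g] and of [f_j], and [(x, t, y)] for the exponents of [x_1],
    [x_2], [y].  The system is a lifting because [g = 0] means [y = h(x_1)], and
    substituting this in [F_j] gives back [f_j].

    For the inequality, the point is that [Q] is a triangle with vertices 0,
    [(m, 0, 0)] and [(0, 0, 1)], contained in the plane [t = 0].  Adding [Q] to a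
    convex body [S] therefore acts separately on each planar slice [S_t], and for
    a planar convex set [K]

      area (K + Q) = area K + (max (x + m y) - min x) - m min y + m / 2,

    the extreme values being taken on [K] ([area_add_triangle]).  Integrated over
    [t] ([sweep_le], [sweep_ge]), this says that [vol (S + Q) - vol S] is the sum
    of three terms.  The first is the area of the shadow of [S], the union of the
    segments from [min x] to [max (x + m y)] over all slices; the shadow of [P_j]
    is exactly [N_j] ([newton_shadow]), because the degree [m] that the division
    by [h] takes from the bottom edge of [N_j] is given back by [m y], and shadows
    commute with Minkowski sums ([solid_shadow_minkowski_sum]).  The second is
    [- m] times the integral of the least height [min y] of the slices.  The third
    is additive in [S].

    Polarization expresses the mixed volume of [P_1], [P_2], [Q] by the values of
    [vol (S + Q) - vol S] at [P_1 + P_2], [P_1] and [P_2], and the mixed area of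
    [N_1], [N_2] by the areas of [N_1 + N_2], [N_1] and [N_2].  The first terms
    thus give the mixed area, the third terms cancel, and what is left is [- m]
    times the excess of the integral of the least height for [P_1 + P_2] over the
    sum of the integrals for [P_1] and [P_2].

    The least height only depends on the projection of [P_j] to the [(t, y)]
    plane, which is the hull of (0, 1) and of a segment from [(s_j, 0)] to
    [(d_j, 0)] with integers [1 <= s_j <= d_j], or just the point (0, 1).  Unless
    both projections are points, the excess is at least one ([profile_joint]),
    which is the claim. *)

Set Implicit Arguments.
Unset Strict Implicit.
Unset Printing Implicit Defensive.

Import Order.TTheory GRing.Theory Num.Theory.
Import numFieldNormedType.Exports.
Local Open Scope classical_set_scope.
Local Open Scope ring_scope.

(** * Measurability of compact sets *)

(** [A] is the intersection over [n] of finite unions of balls of radius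
    [1 / n.+1] centred in [A]. *)
Lemma compact_in_sigma_algebra (R : realType) (T : pseudoMetricType R)
    (M : set (set T)) (A : set T) :
  sigma_algebra setT M -> (forall x e, M (ball x e)) ->
  closed A -> compact A -> M A.
Proof.
move=> [M0 MC MU] Mball clA coA.
have MU2 : forall s : seq T, forall e, M (\bigcup_(x in [set` s]) ball x e).
  move=> s e.
  have -> : \bigcup_(x in [set` s]) ball x e =
     \bigcup_i (if (i < size s)%N then nth set0 [seq ball x e | x <- s] i else set0).
    apply/seteqP; split => [y [x /= xs xy]|y [i _]].
      exists (index x s) => //; rewrite index_mem xs (nth_map x) ?index_mem //.
      by rewrite nth_index.
    case: ifPn => // si.
    case: s si => // a s si; rewrite (nth_map a) // => yb.
    by exists (nth a (a :: s) i) => //=; rewrite mem_nth.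
  apply: MU => i; case: ifPn => // si.
  by case: s si => // a s si; rewrite (nth_map a).
have cover (n : nat) : exists s : seq T, {in s, forall x, A x} /\
   A `<=` \bigcup_(x in [set` s]) ball x n.+1%:R^-1.
  have n0 : 0 < n.+1%:R^-1 :> R by rewrite invr_gt0 ltr0n.
  (* Eventually all finite lists: this filter turns a near covering into a finite
     cover. *)
  pose F := [set U : set (seq T) | exists s0 : seq T,
     forall s : seq T, {subset s0 <= s} -> U s].
  have FF : Filter F.
    split; first by exists [::].
      move=> U V [s1 U1] [s2 V2]; exists (s1 ++ s2) => s ss; split.
        by apply: U1 => x xs; apply: ss; rewrite mem_cat xs.
      by apply: V2 => x xs; apply: ss; rewrite mem_cat xs orbT.
    by move=> U V UV [s0 Us0]; exists s0 => s /Us0/UV.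
  move: (coA) => /compact_near_coveringP /(_ _ F (fun (s : seq T) x' => exists y,
    [/\ y \in s, A y & ball y n.+1%:R^-1 x']) FF)[].
    move=> x Ax; exists (ball x n.+1%:R^-1, [set s : seq T | x \in s]).
      by split; [exact: nbhsx_ballx|exists [:: x] => s; apply; rewrite mem_head].
    by move=> [x' s] /= [xx' xs]; exists x; split.
  move=> s0 /(_ s0 (fun _ => id)) As0.
  exists [seq y <- s0 | `[< A y >]]; split.
    by move=> x; rewrite mem_filter => /andP[/asboolP].
  move=> x /As0 [y [ys Ay xy]]; exists y => //=.
  by rewrite mem_filter ys andbT; exact/asboolP.
have [s sP] := choice cover.
have -> : A = \bigcap_n \bigcup_(x in [set` s n]) ball x n.+1%:R^-1.
  apply/seteqP; split => [x Ax n _|x xA]; first by have [_ h] := sP n; exact: h.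
  apply: clA => B /nbhs_ballP[e /= e0 eB].
  have [N _ Ne] : exists2 N : nat, True & N.+1%:R^-1 < e.
    exists (Num.truncn e^-1) => //.
    by rewrite invf_plt ?posrE ?ltr0n// truncnS_gt.
  have [y /= yN yx] := xA N I.
  exists y; split; first by have [h _] := sP N; exact: h.
  apply: eB; apply: ball_sym; apply: le_ball yx; exact/ltW.
rewrite -[X in M X]setCK setC_bigcap -[~` _]setTD; apply: (MC _).
by apply: MU => n; rewrite -setTD; apply: (MC _).
Qed.

Section measurable_compact.
Context (R : realType).

Lemma compact_measurable2 (A : set (R * R)) : compact A -> measurable A.
Proof.
move=> cA; apply: (@compact_in_sigma_algebra R (R * R)%type measurable) => //.
- split; [exact: measurable0|by move=> B mB; apply: measurableD|].
  by move=> F mF; exact: bigcup_measurable.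
- move=> [x y] e.
  have -> : ball (x, y) e = ball x e `*` ball y e by [].
  by apply: measurableX; rewrite ball_itv; exact: measurable_itv.
- apply: compact_closed cA.
  exact: norm_hausdorff.
Qed.

Lemma compact_measurable3 (A : set (R * R * R)) : compact A -> measurable A.
Proof.
move=> cA; apply: (@compact_in_sigma_algebra R (R * R * R)%type measurable) => //.
- split; [exact: measurable0|by move=> B mB; apply: measurableD|].
  by move=> F mF; exact: bigcup_measurable.
- move=> [[x y] z] e.
  have -> : ball (x, y, z) e = (ball x e `*` ball y e) `*` ball z e by [].
  by do 2?apply: measurableX; rewrite ball_itv; exact: measurable_itv.
- apply: compact_closed cA.
  exact: norm_hausdorff.
Qed.

End measurable_compact.

(** * Fibers of planar convex sets *)

Lemma convexP (R : realType) (V : lmodType R) (A : set V) :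
  convex_set (A : set (convex_lmodType V)) <->
  forall x y (t : R), 0 <= t -> t <= 1 -> A x -> A y ->
    A (t *: x + (1 - t) *: y).
Proof.
split => [cA x y t t0 t1 Ax Ay|cA x y l /set_mem xA /set_mem yA].
  pose l := Itv01 t0 t1.
  by have := cA x y l; rewrite !in_setE => /(_ Ax Ay).
by apply/mem_set; apply: cA.
Qed.

Section fibers.
Context (R : realType).
Local Notation mu := (@lebesgue_measure R).
Implicit Types (K F : set (R * R)).

Lemma compact_interval (I : set R) : compact I -> is_interval I -> I !=set0 ->
  exists a b, a <= b /\ I = `[a, b]%classic.
Proof.
move=> cI iI I0.
have cid : {within I, continuous (fun x : R => x)}.
  by apply: continuous_subspaceT => x; exact: cvg_id.
have [a /set_mem aI mina] := compact_EVT_min I0 cI cid.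
have [b /set_mem bI maxb] := compact_EVT_max I0 cI cid.
exists a, b; split; first exact/maxb/mem_set.
apply/seteqP; split => [x xI|x /=].
  by rewrite /= in_itv/= mina ?maxb//; exact/mem_set.
by rewrite in_itv/= => xab; exact: iI aI bI _ xab.
Qed.

Lemma compact_convex_itv (V : normedModType R) (E : set V) (f : V -> R) :
  continuous f ->
  (forall x y (t : R), f (t *: x + (1 - t) *: y) = t * f x + (1 - t) * f y) ->
  compact E -> convex_set (E : set (convex_lmodType V)) -> E !=set0 ->
  exists a b, a <= b /\ f @` E = `[a, b]%classic.
Proof.
move=> cf lf cE /convexP vE [e Ee]; apply: compact_interval.
- by apply: continuous_compact => //; exact: continuous_subspaceT.
- move=> _ _ [p Ep <-] [q Eq <-] z /andP[pz zq].
  have [pq|pq] := eqVneq (f p) (f q).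
    by exists p => //; apply/eqP; rewrite eq_le pz /= pq zq.
  have pq0 : 0 < f q - f p by rewrite subr_gt0 lt_neqAle pq (le_trans pz).
  exists ((f q - z) / (f q - f p) *: p + (1 - (f q - z) / (f q - f p)) *: q).
    apply: vE => //; first by rewrite divr_ge0 ?(ltW pq0)// subr_ge0.
    by rewrite ler_pdivrMr// mul1r lerB.
  by rewrite lf; field; rewrite gt_eqF.
- by exists (f e), e.
Qed.

Lemma closed_proj1 (a : R) : closed [set p : R * R | p.1 = a].
Proof.
have -> : [set p : R * R | p.1 = a] = fst @^-1` [set a] by [].
apply: preimage_closed; last exact: closed_eq.
by move=> ? _; exact: cvg_fst.
Qed.

Lemma closed_proj2 (a : R) : closed [set p : R * R | p.2 = a].
Proof.
have -> : [set p : R * R | p.2 = a] = snd @^-1` [set a] by [].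
apply: preimage_closed; last exact: closed_eq.
by move=> ? _; exact: cvg_snd.
Qed.

Lemma xfiber_itv K x :
  compact K -> convex_set (K : set (convex_lmodType (R * R)%type)) ->
  [set y | K (x, y)] !=set0 ->
  exists a b, a <= b /\ [set y | K (x, y)] = `[a, b]%classic.
Proof.
move=> cK vK [y0 Ky0].
have -> : [set y | K (x, y)] = snd @` (K `&` [set p | p.1 = x]).
  apply/seteqP; split => [y Ky|_ [[a b] /= [Kab <-] <-]//].
  by exists (x, y).
apply: (@compact_convex_itv (R * R)%type) => //.
- by move=> ?; exact: cvg_snd.
- by apply: compact_closedI => //; exact: closed_proj1.
- move/convexP : vK => vK; apply/convexP => p q t t0 t1 [Kp px] [Kq qx].
  split; first exact: vK.
  by rewrite /= in px qx *; rewrite px qx -scalerDl addrC subrK scale1r.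
- by exists (x, y0).
Qed.

Lemma yfiber_itv K y :
  compact K -> convex_set (K : set (convex_lmodType (R * R)%type)) ->
  [set x | K (x, y)] !=set0 ->
  exists a b, a <= b /\ [set x | K (x, y)] = `[a, b]%classic.
Proof.
move=> cK vK [x0 Kx0].
have -> : [set x | K (x, y)] = fst @` (K `&` [set p | p.2 = y]).
  apply/seteqP; split => [x Kx|_ [[a b] /= [Kab <-] <-]//].
  by exists (x, y).
apply: (@compact_convex_itv (R * R)%type) => //.
- by move=> ?; exact: cvg_fst.
- by apply: compact_closedI => //; exact: closed_proj2.
- move/convexP : vK => vK; apply/convexP => p q t t0 t1 [Kp px] [Kq qx].
  split; first exact: vK.
  by rewrite /= in px qx *; rewrite px qx -scalerDl addrC subrK scale1r.
- by exists (x0, y).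
Qed.

Lemma length_itv (a b : R) : a <= b -> mu `[a, b] = (b - a)%:E.
Proof.
move=> ab; rewrite lebesgue_measure_itv/= lte_fin; case: ifPn => //.
by rewrite -leNgt => ba; rewrite (_ : a = b) ?subrr//; apply/eqP; rewrite eq_le ab.
Qed.

Lemma measurable_xfiber K (D : set R) : measurable K ->
  measurable_fun D (fun x => mu [set y | K (x, y)]).
Proof.
move=> mK; apply: measurable_funTS.
have -> : (fun x => mu [set y | K (x, y)]) = mu \o xsection K.
  by apply/funext => x /=; rewrite xsectionE.
exact: measurable_fun_xsection.
Qed.

Lemma measurable_yfiber K (D : set R) : measurable K ->
  measurable_fun D (fun y => mu [set x | K (x, y)]).
Proof.
move=> mK; apply: measurable_funTS.
have -> : (fun y => mu [set x | K (x, y)]) = mu \o ysection K.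
  by apply/funext => x /=; rewrite ysectionE.
exact: measurable_fun_ysection.
Qed.

Lemma area_xfiber K a b : (forall x y, K (x, y) -> a <= x <= b) ->
  (mu \x mu)%E K = (\int[mu]_(x in `[a, b]) mu [set y | K (x, y)])%E.
Proof.
move=> Kab; rewrite /product_measure1 [RHS]integral_mkcond.
apply: eq_integral => x _ /=; rewrite xsectionE patchE; case: ifPn => //.
move=> /negP xab; rewrite (_ : _ @^-1` _ = set0) ?measure0//.
apply/seteqP; split => // y Kxy; apply: xab; apply/mem_set => /=.
by rewrite in_itv/=; exact: Kab Kxy.
Qed.

Lemma area_yfiber K a b : measurable K -> (forall x y, K (x, y) -> a <= y <= b) ->
  (mu \x mu)%E K = (\int[mu]_(y in `[a, b]) mu [set x | K (x, y)])%E.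
Proof.
move=> mK Kab.
rewrite (@product_measure_unique _ _ _ _ _ mu mu (mu \x^ mu)%E)//; last first.
  by move=> A B mA mB; exact: (product_measure2E _ _ mA mB).
rewrite [RHS]integral_mkcond [LHS]/=.
change ((mu \x^ mu)%E K =
  (\int[mu]_x ((fun y => mu [set x | K (x, y)]) \_ `[a, b]) x)%E).
rewrite /product_measure2.
apply: eq_integral => x _ /=; rewrite ysectionE patchE; case: ifPn => //.
move=> /negP xab; rewrite (_ : _ @^-1` _ = set0) ?measure0//.
apply/seteqP; split => // y Kxy; apply: xab; apply/mem_set => /=.
by rewrite in_itv/=; exact: Kab Kxy.
Qed.

Lemma integral_affine (a b u v : R) : a <= b ->
  (\int[mu]_(x in `[a, b]) (u + v * x)%:E)%E =
  (u * (b - a) + v * ((b ^+ 2 - a ^+ 2) / 2))%:E.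
Proof.
rewrite le_eqVlt => /predU1P[->|ab].
  by rewrite set_itv1 integral_set1 !subrr mul0r !mulr0 addr0.
pose G (x : R) : R := u * x + v / 2 * x ^+ 2.
have dG (x : R) : is_derive x 1 G (u + v * x).
  by rewrite /G; apply: is_derive_eq; rewrite /GRing.scale /=; field.
transitivity ((G b)%:E - (G a)%:E)%E; last first.
  by rewrite -EFinB; congr (_%:E); rewrite /G; field.
apply: continuous_FTC2 => //.
- apply: continuous_subspaceT => x; apply: cvgD; first exact: cvg_cst.
  by apply: cvgM; [exact: cvg_cst|exact: cvg_id].
- have cG (x : R) : G y @[y --> x] --> G x.
    by apply: differentiable_continuous; apply/derivable1_diffP; have [] := dG x.
  split.
  + by move=> x _; have [] := dG x.
  + by apply: cvg_at_right_filter; exact: cG.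
  + by apply: cvg_at_left_filter; exact: cG.
- by move=> x _; rewrite derive1E; have [_] := dG x.
Qed.

End fibers.

(** * Sums with a segment and with a triangle *)

Lemma cvg_fst_of (T U V : topologicalType) (f : T -> U * V) (x : T) (l : U * V) :
  f z @[z --> x] --> l -> (f z).1 @[z --> x] --> l.1.
Proof. by move=> fl; exact: (cvg_comp _ _ fl (@cvg_fst _ _ _ _ _)). Qed.

Lemma cvg_snd_of (T U V : topologicalType) (f : T -> U * V) (x : T) (l : U * V) :
  f z @[z --> x] --> l -> (f z).2 @[z --> x] --> l.2.
Proof. by move=> fl; exact: (cvg_comp _ _ fl (@cvg_snd _ _ _ _ _)). Qed.

Lemma cvg_pair_of (T U V : topologicalType) (f : T -> U) (g : T -> V)
    (x : T) (a : U) (b : V) :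
  f z @[z --> x] --> a -> g z @[z --> x] --> b ->
  (f z, g z) @[z --> x] --> (a, b).
Proof. by move=> fa gb; apply: (@cvg_pair _ _ _ _ (nbhs a) (nbhs b)). Qed.

Section cvg_arith.
Context (R : realType) (T : topologicalType).
Variables (f g : T -> R) (x : T) (a b : R).
Hypotheses (fa : f z @[z --> x] --> a) (gb : g z @[z --> x] --> b).

Lemma cvg_add_of : f z + g z @[z --> x] --> a + b.
Proof. exact: cvgD. Qed.

Lemma cvg_opp_of : - f z @[z --> x] --> - a.
Proof. exact: cvgN. Qed.

Lemma cvg_mul_of : f z * g z @[z --> x] --> a * b.
Proof. exact: cvgM. Qed.

End cvg_arith.

Ltac continuity := move=> ?; rewrite /continuous_at;
  repeat first [exact: cvg_cst | exact: cvg_id | apply: cvg_pair_of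
    | apply: cvg_add_of | apply: cvg_opp_of | apply: cvg_mul_of
    | apply: cvg_fst_of | apply: cvg_snd_of].

Lemma eq_adde_shift (R : realType) (a b : \bar R) (r1 r2 s1 s2 : R) :
  (a + r1%:E = b + r2%:E)%E -> r1 + s2 = r2 + s1 ->
  (a + s1%:E = b + s2%:E)%E.
Proof.
case: a b => [a| |] [b| |]// /= => -[E1] E2; congr (_%:E); lra.
Qed.

Section triangle.
Context (R : realType).
Local Notation mu := (@lebesgue_measure R).
Local Notation convex K := (convex_set (K : set (convex_lmodType (R * R)%type))).
Implicit Types (K F : set (R * R)).

(** The Minkowski sum of [F] and the segment from (0, 0) to (0, 1). *)
Definition upstretch F : set (R * R) :=
  [set p | exists v, [/\ 0 <= v, v <= 1 & F (p.1, p.2 - v)]].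

(** The points to the right of some point of [F], up to the line [x = M]: only
    the left boundary of [F] is remembered. *)
Definition rightward (M : R) F : set (R * R) :=
  [set p | p.1 <= M /\ exists x, x <= p.1 /\ F (x, p.2)].

(** An involution that turns the boundary of [F] where [x + m * y] is largest
    into a left boundary. *)
Definition shear_reflect (m : R) F : set (R * R) :=
  [set p | F (- p.1 - m * p.2, p.2)].

(** The Minkowski sum of [F] and the triangle with vertices (0, 0), [(m, 0)] and
    (0, 1). *)
Definition add_triangle (m : R) F : set (R * R) :=
  [set p | exists u v, [/\ 0 <= v, v <= 1, 0 <= u, u <= m * (1 - v)
     & F (p.1 - u, p.2 - v)]].

Lemma convex2P K : convex K <->
  forall x y x' y' t, 0 <= t -> t <= 1 -> K (x, y) -> K (x', y') ->
   K (t * x + (1 - t) * x', t * y + (1 - t) * y').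
Proof.
split => [/convexP vK x y x' y' t t0 t1 K1 K2|vK].
  exact: (vK _ _ t t0 t1 K1 K2).
by apply/convexP => -[x y] [x' y'] t t0 t1 K1 K2; exact: vK.
Qed.

Lemma compact_unit : compact `[0 : R, 1].
Proof. exact: segment_compact. Qed.

Lemma compact_upstretch F : compact F -> compact (upstretch F).
Proof.
move=> cF; have -> : upstretch F =
    (fun q : (R * R) * R => (q.1.1, q.1.2 + q.2)) @` (F `*` `[0, 1]).
  apply/seteqP; split => [[x y] /= [v [v0 v1 Fv]]|_ [[[x y] v] /= [Fxy]] + <-].
    exists ((x, y - v), v) => /=; last by rewrite subrK.
    by split => //; rewrite in_itv/= v0 v1.
  by rewrite in_itv/= => /andP[v0 v1]; exists v; rewrite addrK.
apply: continuous_compact; last by apply: compact_setX => //; exact: compact_unit.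
by apply: continuous_subspaceT; continuity.
Qed.

Lemma compact_rightward M F : compact F -> (forall p, F p -> p.1 <= M) ->
  compact (rightward M F).
Proof.
move=> cF FM; have -> : rightward M F =
    (fun q : (R * R) * R => (q.1.1 + q.2 * (M - q.1.1), q.1.2)) @` (F `*` `[0, 1]).
  apply/seteqP; split => [[x y] /= [xM [x' [x'x Fx']]]|_ [[[x y] v] /= [Fxy]] + <-].
    have [xE|xM'] := eqVneq M x'.
      exists ((x', y), 0) => /=; first by rewrite in_itv/= lexx ler01.
      by rewrite mul0r addr0; congr pair; apply/eqP; rewrite eq_le x'x -xE.
    have Mx' : 0 < M - x' by rewrite subr_gt0 lt_neqAle eq_sym xM' (le_trans x'x).
    exists ((x', y), (x - x') / (M - x')) => /=.
      split => //; rewrite in_itv/= divr_ge0 ?subr_ge0 ?(ltW Mx')//=.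
        by rewrite ler_pdivrMr// mul1r lerB.
      by rewrite -subr_ge0 ltW.
    by congr pair; field; rewrite gt_eqF.
  rewrite in_itv/= => /andP[v0 v1]; have /= xM := FM _ Fxy.
  by split => /=; [nra|exists x; split => //; nra].
apply: continuous_compact; last by apply: compact_setX => //; exact: compact_unit.
by apply: continuous_subspaceT; continuity.
Qed.

Lemma convex_rightward M F : convex F -> convex (rightward M F).
Proof.
move=> /convex2P vF; apply/convex2P.
move=> x y x' y' t t0 t1 [/= xM [z [zx Fz]]] [/= xM' [z' [zx' Fz']]].
split => /=; first by nra.
by exists (t * z + (1 - t) * z'); split; [nra|exact: vF].
Qed.

Lemma compact_shear_reflect m F : compact F -> compact (shear_reflect m F).
Proof.
move=> cF; have -> : shear_reflect m F =
    (fun q : R * R => (- q.1 - m * q.2, q.2)) @` F.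
  apply/seteqP; split => [[x y] /= Fxy|_ [[x y] /= Fxy <-]].
    by exists (- x - m * y, y) => //=; congr pair; ring.
  by rewrite /shear_reflect/=; have -> : - (- x - m * y) - m * y = x by ring.
apply: continuous_compact => //.
by apply: continuous_subspaceT; continuity.
Qed.

Lemma convex_shear_reflect m F : convex F -> convex (shear_reflect m F).
Proof.
move=> /convex2P vF; apply/convex2P => x y x' y' t t0 t1 /= F1 F2.
rewrite /shear_reflect/=.
have -> : - (t * x + (1 - t) * x') - m * (t * y + (1 - t) * y') =
  t * (- x - m * y) + (1 - t) * (- x' - m * y') by ring.
exact: vF.
Qed.

Lemma compact_add_triangle m F : 0 <= m -> compact F -> compact (add_triangle m F).
Proof.
move=> m0 cF; have -> : add_triangle m F =
    (fun q : (R * R) * (R * R) =>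
      (q.1.1 + q.2.2 * (m * (1 - q.2.1)), q.1.2 + q.2.1))
    @` (F `*` (`[0, 1] `*` `[0, 1])).
  apply/seteqP; split => [[x y] /= [u [v [v0 v1 u0 um Fv]]]|].
    have [E|um'] := eqVneq (m * (1 - v)) 0.
      have u00 : u = 0 by apply/eqP; rewrite eq_le u0 andbT -E.
      exists ((x - u, y - v), (v, 0)) => /=.
        by rewrite !in_itv/= v0 v1 lexx ler01.
      by rewrite mul0r u00 addr0 subr0 subrK.
    have um0 : 0 < m * (1 - v) by rewrite lt_neqAle eq_sym um' (le_trans u0).
    exists ((x - u, y - v), (v, u / (m * (1 - v)))) => /=.
      by rewrite !in_itv/= v0 v1 divr_ge0 ?(ltW um0)//= ler_pdivrMr// mul1r.
    by congr pair; [rewrite divfK ?subrK|rewrite subrK].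
  move=> _ [[[x y] [v s]] /= [Fxy]] + <-.
  rewrite !in_itv/= => -[/andP[v0 v1] /andP[s0 s1]].
  exists (s * (m * (1 - v))), v; rewrite /= !addrK; split => //.
    by rewrite mulr_ge0// mulr_ge0// subr_ge0.
  by rewrite ler_piMl// mulr_ge0// subr_ge0.
apply: continuous_compact; last first.
  by apply: compact_setX => //; apply: compact_setX; exact: compact_unit.
by apply: continuous_subspaceT; continuity.
Qed.

Lemma convex_add_triangle m F : convex F -> convex (add_triangle m F).
Proof.
move=> /convex2P vF; apply/convex2P => x y x' y' t t0 t1.
move=> [u [v [/= v0 v1 u0 um Fu]]] [u' [v' [/= v0' v1' u0' um' Fu']]].
exists (t * u + (1 - t) * u'), (t * v + (1 - t) * v'); split => /=; [nra|nra|nra| |].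
  have -> : m * (1 - (t * v + (1 - t) * v')) =
     t * (m * (1 - v)) + (1 - t) * (m * (1 - v')) by ring.
  by apply: lerD; apply: ler_wpM2l => //; rewrite subr_ge0.
have -> : t * x + (1 - t) * x' - (t * u + (1 - t) * u') =
  t * (x - u) + (1 - t) * (x' - u') by ring.
have -> : t * y + (1 - t) * y' - (t * v + (1 - t) * v') =
  t * (y - v) + (1 - t) * (y' - v') by ring.
exact: vF.
Qed.

(** A vertical fiber of [F] is a segment, and the sum lengthens it by one. *)
Lemma area_upstretch F a b : compact F -> convex F -> a <= b ->
  fst @` F = `[a, b]%classic ->
  ((mu \x mu) (upstretch F) = (mu \x mu) F + (b - a)%:E)%E.
Proof.
move=> cF vF ab Fab.
have inab x y : F (x, y) -> a <= x <= b.
  move=> Fxy; have : (fst @` F) x by exists (x, y).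
  by rewrite Fab /= in_itv.
rewrite (@area_xfiber _ _ a b); last by move=> x y [v [_ _ /inab]].
rewrite (@area_xfiber _ F a b)//.
have <- : (\int[mu]_(x in `[a, b]) (cst 1 x))%E = (b - a)%:E :> \bar R.
  by rewrite integral_cst// mul1e; exact: length_itv.
rewrite -ge0_integralD//; last first.
  by apply: measurable_xfiber; exact: compact_measurable2.
apply: eq_integral => x; rewrite inE => xab.
have [y Fxy] : [set y | F (x, y)] !=set0.
  have : (fst @` F) x by rewrite Fab.
  by move=> [[x' y] /= Fxy <-]; exists y.
have [|c [d [cd Fcd]]] := xfiber_itv (x := x) cF vF; first by exists y.
rewrite Fcd length_itv// /= -EFinD.
have -> : [set y | upstretch F (x, y)] = `[c, d + 1]%classic.
  have FP z : F (x, z) <-> c <= z <= d.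
    have <- : [set y | F (x, y)] z = F (x, z) by [].
    by rewrite Fcd /= in_itv.
  apply/seteqP; split => [z [v /= [v0 v1 /FP/andP[]]]|z /=].
    by rewrite in_itv/= => ? ?; lra.
  rewrite in_itv/= => /andP[cz zd].
  have [zd'|dz] := leP z d.
    by exists 0; rewrite lexx ler01 subr0/=; split => //; apply/FP; rewrite cz.
  by exists (z - d); split => /=; [lra|lra|apply/FP; rewrite subKr cd lexx].
rewrite [LHS]length_itv; [congr (_%:E); lra|lra].
Qed.

End triangle.

(** * The area of the sum with a triangle *)

Section area_triangle.
Context (R : realType).
Local Notation mu := (@lebesgue_measure R).
Local Notation convex K := (convex_set (K : set (convex_lmodType (R * R)%type))).
Implicit Types (K F : set (R * R)).

Lemma itv_fiber (P : R -> Prop) (a b : R) :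
  [set x | P x] = `[a, b]%classic -> forall x, P x <-> a <= x <= b.
Proof.
by move=> E x; have -> : P x = [set x | P x] x by []; rewrite E /= in_itv.
Qed.

Lemma itv_fiberV (P : R -> Prop) (a b : R) :
  (forall x, P x <-> a <= x <= b) -> [set x | P x] = `[a, b]%classic.
Proof.
by move=> E; apply/seteqP; split => x /=; rewrite in_itv/= => /E.
Qed.

Lemma image_itv (T : Type) (f : T -> R) (A : set T) (a b : R) :
  f @` A = `[a, b]%classic -> forall p, A p -> a <= f p <= b.
Proof.
by move=> E p Ap; have : (f @` A) (f p) by [exists p]; rewrite E /= in_itv.
Qed.

Lemma image_itv_surj (T : Type) (f : T -> R) (A : set T) (a b : R) :
  f @` A = `[a, b]%classic -> forall x, a <= x <= b -> exists2 p, A p & f p = x.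
Proof. by move=> E x xab; have : (f @` A) x by rewrite E /= in_itv. Qed.

Lemma measurable_affine (D : set R) (u v : R) :
  measurable_fun D (fun x => u + v * x).
Proof.
by apply: measurable_funTS; apply: continuous_measurable_fun; continuity.
Qed.

(** The length [r - l] of a fiber is [(M - l) + (M + (r + m * y))] minus a term
    affine in [y], so the area of [K] splits into a contribution of its left
    boundary and one of its right boundary. *)
Lemma yfiber_halves (m M : R) K y l r :
  [set x | K (x, y)] = `[l, r]%classic -> l <= r -> r <= M ->
  - (l + m * y) <= M ->
  [set x | rightward M K (x, y)] = `[l, M]%classic /\
  [set x | rightward M (shear_reflect m K) (x, y)] =
    `[- (r + m * y), M]%classic.
Proof.
move=> Klr lr rM lM; have KP := itv_fiber Klr; split; apply: itv_fiberV => z; split.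
- move=> [/= -> [x [xz /KP/andP[lx _]]]]; rewrite andbT.
  exact: le_trans xz.
- move=> /andP[lz zM]; split => //; exists l; split => //.
  by apply/KP; rewrite lexx lr.
- move=> [/= -> [x [xz /KP/=/andP[lx xr]]]]; rewrite andbT; lra.
- move=> /andP[lz zM]; split => //; exists (- (r + m * y)); split => //.
  by apply/KP => /=; apply/andP; split; lra.
Qed.

(** Only the vertical edge of the triangle moves the left boundary of [K], and
    only the slanted edge, on which [x + m * y] is constant, moves the right one:
    each boundary sees the sum with a segment. *)
Lemma yfiber_triangle_halves (m M : R) K z l r : 0 <= m ->
  (forall p, K p -> p.1 <= M) -> (forall p, K p -> - (p.1 + m * p.2) <= M) ->
  [set x | add_triangle m K (x, z)] = `[l, r]%classic -> l <= r ->
  [/\ l <= M, - (r + m * z - m) <= M,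
      [set x | upstretch (rightward M K) (x, z)] = `[l, M]%classic &
      [set x | upstretch (rightward M (shear_reflect m K)) (x, z)] =
        `[- (r + m * z - m), M]%classic].
Proof.
move=> m0 KM KM' Tlr lr; have TP := itv_fiber Tlr.
have rP : add_triangle m K (r, z) by apply/TP; rewrite lr lexx.
have lP : add_triangle m K (l, z) by apply/TP; rewrite lr lexx.
have [ul [vl [vl0 vl1 ul0 ulm /= Kl]]] := lP.
have [ur [vr [vr0 vr1 ur0 urm /= Kr]]] := rP.
have ul00 : ul = 0.
  apply/eqP; rewrite eq_le ul0 andbT.
  suff /TP/andP[+ _] : add_triangle m K (l - ul, z) by lra.
  by exists 0, vl; rewrite /= subr0; split => //; rewrite (le_trans ul0).
have urE : ur = m * (1 - vr).
  apply/eqP; rewrite eq_le urm/=.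
  suff /TP/andP[_ +] : add_triangle m K (r - ur + m * (1 - vr), z) by lra.
  exists (m * (1 - vr)), vr; rewrite /= addrK; split => //.
  by rewrite (le_trans ur0).
have lM : l <= M by move: (KM _ Kl) => /=; rewrite ul00 subr0.
have rM : - (r + m * z - m) <= M.
  by move: (KM' _ Kr) => /=; rewrite urE; lra.
split => //; apply: itv_fiberV => w; split.
- move=> [v [v0 v1 [/= -> [x [xw Kx]]]]]; rewrite andbT (le_trans _ xw)//.
  suff /TP/andP[] : add_triangle m K (x, z) by [].
  by exists 0, v; rewrite subr0; split => //; apply: mulr_ge0; lra.
- move=> /andP[lw wM]; exists vl; split => //; split => //=.
  by exists l; split => //; move: Kl; rewrite ul00 subr0.
- move=> [v [v0 v1 [/= -> [x [xw Kx]]]]]; rewrite andbT (le_trans _ xw)//.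
  suff /TP/andP[_] :
    add_triangle m K (- x - m * (z - v) + m * (1 - v), z) by lra.
  exists (m * (1 - v)), v; rewrite /= addrK; split => //.
  by apply: mulr_ge0; lra.
- move=> /andP[rw wM]; exists vr; split => //; split => //=.
  exists (- (r + m * z - m)); split => //.
  rewrite /shear_reflect /=; move: Kr; rewrite urE.
  by have -> : r - m * (1 - vr) = - - (r + m * z - m) - m * (z - vr) by ring.
Qed.

Lemma area_halves (E F G : set (R * R)) (c d u v : R) :
  compact E -> compact F -> compact G -> c <= d ->
  (forall x y, E (x, y) -> c <= y <= d) ->
  (forall x y, F (x, y) -> c <= y <= d) ->
  (forall x y, G (x, y) -> c <= y <= d) ->
  (forall y, c <= y <= d -> 0 <= u + v * y) ->
  (forall y, c <= y <= d -> (mu [set x | E (x, y)] + (u + v * y)%:E =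
     mu [set x | F (x, y)] + mu [set x | G (x, y)])%E) ->
  ((mu \x mu) E + (u * (d - c) + v * ((d ^+ 2 - c ^+ 2) / 2))%:E =
   (mu \x mu) F + (mu \x mu) G)%E.
Proof.
move=> /compact_measurable2 mE /compact_measurable2 mF /compact_measurable2 mG.
move=> cd Ecd Fcd Gcd uv_ge0 EFG.
rewrite -integral_affine// (area_yfiber mE Ecd) (area_yfiber mF Fcd).
rewrite (area_yfiber mG Gcd).
have uv0 y : `[c, d]%classic y -> (0 <= (u + v * y)%:E)%E.
  by rewrite /= in_itv/= lee_fin; exact: uv_ge0.
have muv : measurable_fun `[c, d] (fun y => (u + v * y)%:E).
  by apply/measurable_EFinP; exact: measurable_affine.
rewrite -ge0_integralD//; last by apply: measurable_yfiber.
rewrite -ge0_integralD//.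
- by apply: eq_integral => y; rewrite inE/= in_itv/= => /EFG.
- by apply: measurable_yfiber.
- by apply: measurable_yfiber.
Qed.

(** The added terms are the mixed area of [K] and the triangle, given by the
    largest values on [K] in the directions (-1, 0), [(1, m)] and (0, -1) of the
    outer normals of the triangle, and the area of the triangle itself.  In the proof, both boundaries
    of [K] are treated as left boundaries, of [L1] and of [L2], which the triangle
    stretches upwards by one. *)
Lemma area_add_triangle (m c d x0 x1 X0 X : R) K :
  0 <= m -> 0 <= c -> c <= d -> compact K -> convex K ->
  snd @` K = `[c, d]%classic -> fst @` K = `[x0, x1]%classic -> x0 <= x1 ->
  (fun p => p.1 + m * p.2) @` K = `[X0, X]%classic -> X0 <= X ->
  ((mu \x mu) (add_triangle m K) + (m * c)%:E =
   (mu \x mu) K + (X - x0 + m / 2)%:E)%E.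
Proof.
move=> m0 c0 cd cK vK Ky Kx x01 KX X0X.
have incd x y : K (x, y) -> c <= y <= d by move=> /(image_itv Ky).
(* [M] lies to the right of [K] and of its sheared reflection; [m <= M] keeps the
   integrands below nonnegative. *)
pose M := `|x1| + `|X0| + m.
have x1M : x1 <= M by rewrite /M; have := ler_norm x1; have := normr_ge0 X0; lra.
have X0M : - X0 <= M.
  rewrite /M; have := ler_norm (- X0); rewrite normrN.
  by have := normr_ge0 x1; lra.
have mM : m <= M by rewrite /M; have := normr_ge0 x1; have := normr_ge0 X0; lra.
have KM p : K p -> p.1 <= M by move=> /(image_itv Kx)/andP[_ /le_trans]; apply.
have KM' p : K p -> - (p.1 + m * p.2) <= M.
  by move=> /(image_itv KX)/andP[? _]; apply: le_trans X0M; rewrite lerN2.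
clearbody M.
pose L1 := rightward M K.
pose L2 := rightward M (shear_reflect m K).
have cL1 : compact L1 by exact: compact_rightward.
have cL2 : compact L2.
  apply: compact_rightward; first exact: compact_shear_reflect.
  by move=> p /KM' /=; lra.
have vL1 : convex L1 by exact: convex_rightward.
have vL2 : convex L2 by apply: convex_rightward; exact: convex_shear_reflect.
have x0M : x0 <= M by exact: le_trans x1M.
have XM : - X <= M by apply: le_trans X0M; rewrite lerN2.
have fL1 : fst @` L1 = `[x0, M]%classic.
  apply/seteqP; split => [_ [[x y] /= [/= xM [x' [x'x Kx']]] <-]|x /=].
    rewrite in_itv/= xM andbT (le_trans _ x'x)//.
    by have /andP[] := image_itv Kx Kx'.
  rewrite in_itv/= => /andP[x0x xM].
  have [|[x' y] Kp /= x'E] := image_itv_surj Kx (x := x0); first by rewrite lexx.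
  by exists (x, y) => //; split => //=; exists x'; rewrite x'E in Kp *.
have fL2 : fst @` L2 = `[- X, M]%classic.
  apply/seteqP; split => [_ [[x y] /= [/= xM [x' [x'x Kx']]] <-]|x /=].
    rewrite in_itv/= xM andbT (le_trans _ x'x)//.
    by have /andP[_ /=] := image_itv KX Kx'; lra.
  rewrite in_itv/= => /andP[Xx xM].
  have [|[x' y] Kp /= XE] := image_itv_surj KX (x := X); first by rewrite lexx andbT.
  exists (x, y) => //; split => //=; exists (- X); split => //.
  by rewrite /shear_reflect/=; have -> : - - X - m * y = x' by lra.
(* [2 * M + m * y] is the excess of the two halves of the fiber of [K] at height
   [y] over that fiber. *)
have EK : ((mu \x mu) K +
    (2 * M * (d - c) + m * ((d ^+ 2 - c ^+ 2) / 2))%:E =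
    (mu \x mu) L1 + (mu \x mu) L2)%E.
  apply: area_halves => //.
  - by move=> x y [_ [x' [_ /incd]]].
  - by move=> x y [_ [x' [_ /incd]]].
  - move=> y /andP[cy _]; apply: addr_ge0; first by apply: mulr_ge0; lra.
    by apply: mulr_ge0 => //; lra.
  move=> y ycd; have [[a y'] Kay /= yE] := image_itv_surj Ky ycd.
  have [|l [r [lr Klr]]] := yfiber_itv (y := y) cK vK; first by exists a; rewrite -yE.
  have rM : r <= M by have /KM : K (r, y) by apply/(itv_fiber Klr); rewrite lr lexx.
  have lM : - (l + m * y) <= M.
    by have /KM' : K (l, y) by apply/(itv_fiber Klr); rewrite lr lexx.
  have [-> ->] := yfiber_halves Klr lr rM lM.
  rewrite Klr !length_itv//; [|lra|lra].
  by rewrite -!EFinD; congr (_%:E); lra.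
(* For the sum, the excess is smaller by [m], the value of [x + m * y] on the
   slanted edge of the triangle. *)
have ET : ((mu \x mu) (add_triangle m K) +
    ((2 * M - m) * (d + 1 - c) + m * (((d + 1) ^+ 2 - c ^+ 2) / 2))%:E =
    (mu \x mu) (upstretch L1) + (mu \x mu) (upstretch L2))%E.
  have inU : forall F, (forall x y, F (x, y) -> c <= y <= d) ->
      forall x y, upstretch F (x, y) -> c <= y <= d + 1.
    by move=> F FF x y [v [v0 v1 /FF/= /andP[? ?]]]; apply/andP; split; lra.
  have cT := compact_add_triangle m0 cK.
  have vT := convex_add_triangle (m := m) vK.
  apply: area_halves => //.
  - exact: compact_upstretch.
  - exact: compact_upstretch.
  - by lra.
  - move=> x y [u [v [/= v0 v1 u0 um /incd/andP[? ?]]]].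
    by apply/andP; split; lra.
  - by apply: inU => x y [_ [x' [_ /incd]]].
  - by apply: inU => x y [_ [x' [_ /incd]]].
  - move=> y /andP[cy _]; apply: addr_ge0; first by lra.
    by apply: mulr_ge0 => //; lra.
  move=> z /andP[cz zd].
  have [x Kxz] : [set x | add_triangle m K (x, z)] !=set0.
    have [zd'|dz] := leP z d.
      have [|[a z'] Kaz /= <-] := image_itv_surj Ky (x := z); first by rewrite cz.
      exists a, 0, 0.
      by rewrite !subr0 lexx ler01; split => //; rewrite mulr1.
    have [|[a d'] Kad /= d'E] := image_itv_surj Ky (x := d); first by rewrite cd lexx.
    exists a, 0, (z - d); rewrite subr0 subKr lexx -d'E; split => //; [lra|lra|].
    by apply: mulr_ge0 => //; lra.
  have [|l [r [lr Klr]]] := yfiber_itv (y := z) cT vT; first by exists x.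
  have [lM rM -> ->] := yfiber_triangle_halves m0 KM KM' Klr lr.
  rewrite Klr !length_itv//.
  by rewrite -!EFinD; congr (_%:E); lra.
have S1 := area_upstretch cL1 vL1 x0M fL1.
have S2 := area_upstretch cL2 vL2 XM fL2.
rewrite S1 S2 addeACA -EFinD -EK -addeA -EFinD in ET.
by apply: eq_adde_shift ET _; field.
Qed.

End area_triangle.

(** * Slicing solids *)

Section slices.
Context (R : realType).
Local Notation mu := (@lebesgue_measure R).
Local Notation convex K := (convex_set (K : set (convex_lmodType (R * R)%type))).
Implicit Types (K : set (R * R)) (S T : set 'rV[R]_3) (N : set 'rV[R]_2).

Definition pt2 (x t : R) : 'rV[R]_2 := \row_i tnth [tuple x; t] i.
Definition pt3 (x t y : R) : 'rV[R]_3 := \row_i tnth [tuple x; t; y] i.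

Definition planar N : set (R * R) := [set p | N (pt2 p.1 p.2)].
Definition spatial S : set (R * R * R) := [set p | S (pt3 p.1.1 p.1.2 p.2)].
Definition slice S (t : R) : set (R * R) := [set p | S (pt3 p.1 t p.2)].

Local Notation area N := ((mu \x mu)%E (planar N)).
Local Notation volume S := (((mu \x mu) \x mu)%E (spatial S)).

(** The segment from the least [x] to the largest [x + m * y] on a compact convex
    [K]; its length is the term [X - x0] of [area_add_triangle]. *)
Definition shadow (m : R) K : set R :=
  [set x | exists p q, [/\ K p, K q, p.1 <= x & x <= q.1 + m * q.2]].

Lemma pt2_eta (v : 'rV[R]_2) : v = pt2 (v 0 0) (v 0 1).
Proof. by apply/rowP => -[[|[|i]] Hi]//; rewrite mxE; congr (v 0 _); apply/val_inj. Qed.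

Lemma pt3_eta (v : 'rV[R]_3) : v = pt3 (v 0 0) (v 0 1) (v 0 2).
Proof. by apply/rowP => -[[|[|[|i]]] Hi]//; rewrite mxE; congr (v 0 _); apply/val_inj. Qed.

Lemma pt2_conv (t x y x' y' : R) : t *: pt2 x y + (1 - t) *: pt2 x' y' =
  pt2 (t * x + (1 - t) * x') (t * y + (1 - t) * y').
Proof. by apply/rowP => -[[|[|i]] Hi]//; rewrite !mxE. Qed.

Lemma pt3_conv (t x y z x' y' z' : R) :
  t *: pt3 x y z + (1 - t) *: pt3 x' y' z' =
  pt3 (t * x + (1 - t) * x') (t * y + (1 - t) * y') (t * z + (1 - t) * z').
Proof. by apply/rowP => -[[|[|[|i]]] Hi]//; rewrite !mxE. Qed.

Lemma pt2_add (x y x' y' : R) : pt2 x y + pt2 x' y' = pt2 (x + x') (y + y').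
Proof. by apply/rowP => -[[|[|i]] Hi]//; rewrite !mxE. Qed.

Lemma pt3_add (x y z x' y' z' : R) :
  pt3 x y z + pt3 x' y' z' = pt3 (x + x') (y + y') (z + z').
Proof. by apply/rowP => -[[|[|[|i]]] Hi]//; rewrite !mxE. Qed.

Lemma compact_planar N : compact N -> compact (planar N).
Proof.
move=> cN; have -> : planar N = (fun v : 'rV[R]_2 => (v 0 0, v 0 1)) @` N.
  apply/seteqP; split => [[x y] Nxy|_ [v Nv <-]].
    by exists (pt2 x y) => //; rewrite !mxE.
  by rewrite /planar/= -pt2_eta.
apply: continuous_compact => //; apply: continuous_subspaceT => v.
by rewrite /continuous_at; apply: cvg_pair_of; exact: coord_continuous.
Qed.

Lemma compact_spatial S : compact S -> compact (spatial S).
Proof.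
move=> cS; have -> : spatial S =
    (fun v : 'rV[R]_3 => (v 0 0, v 0 1, v 0 2)) @` S.
  apply/seteqP; split => [[[x t] y] Nxy|_ [v Nv <-]].
    by exists (pt3 x t y) => //; rewrite !mxE.
  by rewrite /spatial/= -pt3_eta.
apply: continuous_compact => //; apply: continuous_subspaceT => v.
by rewrite /continuous_at; do 2?apply: cvg_pair_of; exact: coord_continuous.
Qed.

Lemma compact_slice S t : compact S -> compact (slice S t).
Proof.
move=> cS; have -> : slice S t =
    (fun v : 'rV[R]_3 => (v 0 0, v 0 2)) @` (S `&` [set v | v 0 1 = t]).
  apply/seteqP; split => [[x y] Sxy|_ [v [Sv /= <-] <-]].
    by exists (pt3 x t y); rewrite ?mxE//; split => //=; rewrite mxE.
  by rewrite /slice/= -pt3_eta.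
apply: continuous_compact; last first.
  apply: compact_closedI => //.
  apply: (@preimage_closed _ _ (fun v : 'rV[R]_3 => v 0 1) [set t]).
    by move=> v _; exact: coord_continuous.
  exact: closed_eq.
apply: continuous_subspaceT => v.
by rewrite /continuous_at; apply: cvg_pair_of; exact: coord_continuous.
Qed.

Lemma convex_slice S t : convex_set (S : set (convex_lmodType 'rV[R]_3)) ->
  convex (slice S t).
Proof.
move=> /convexP vS; apply/convex2P => x y x' y' s s0 s1 S1 S2.
have := vS _ _ s s0 s1 S1 S2; rewrite pt3_conv /slice /=.
by have -> : s * t + (1 - s) * t = t by ring.
Qed.

Lemma measurable_slice S (D : set R) : compact S ->
  measurable_fun D (fun t => (mu \x mu)%E (slice S t)).
Proof.
move=> /compact_spatial/compact_measurable3 mS; apply: measurable_funTS.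
exact: (measurable_fun_fubini_tonelli_G (m1 := mu) _
  (measurable_fun_xsection mu mS) (fun=> measure_ge0 _ _)).
Qed.

(** Tonelli's theorem, with the second coordinate as the outer variable. *)
Lemma volume_slice S a b : compact S ->
  (forall x t y, S (pt3 x t y) -> a <= t <= b) ->
  volume S = (\int[mu]_(t in `[a, b]) (mu \x mu) (slice S t))%E.
Proof.
move=> /compact_spatial/compact_measurable3 mS Sab.
rewrite [LHS]/product_measure1.
transitivity (\int[mu]_t (fubini_G mu (mu \o xsection (spatial S)) t))%E.
  apply: fubini_tonelli2; first exact: measurable_fun_xsection.
  by move=> p; exact: measure_ge0.
rewrite [RHS]integral_mkcond; apply: eq_integral => t _ /=; rewrite patchE.
have -> : fubini_G mu (mu \o xsection (spatial S)) t = (mu \x mu)%E (slice S t).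
  rewrite /fubini_G /product_measure1; apply: eq_integral => x _ /=.
  by rewrite !xsectionE.
case: ifPn => // /negP tab; rewrite (_ : slice S t = set0) ?measure0//.
apply/seteqP; split => // -[x y] /Sab tab'; apply: tab.
by rewrite inE/= in_itv.
Qed.

Lemma area_slice N a b : compact N ->
  (forall x t, N (pt2 x t) -> a <= t <= b) ->
  area N = (\int[mu]_(t in `[a, b]) mu [set x | N (pt2 x t)])%E.
Proof.
move=> /compact_planar/compact_measurable2 mN Nab.
exact: (area_yfiber mN).
Qed.

Lemma area_add_triangle_shadow (m : R) K : 0 <= m -> compact K -> convex K ->
  K !=set0 -> (forall p, K p -> 0 <= p.2) ->
  exists c, [/\ 0 <= c, (exists2 p, K p & p.2 = c), (forall p, K p -> c <= p.2)
   & ((mu \x mu) (add_triangle m K) + (m * c)%:E =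
      (mu \x mu) K + (mu (shadow m K) + (m / 2)%:E))%E].
Proof.
move=> m0 cK vK K0 K_ge0.
have [c [d [cd Ky]]] : exists a b, a <= b /\ snd @` K = `[a, b]%classic.
  by apply: (@compact_convex_itv _ (R * R)%type) => // x; exact: cvg_snd.
have [x0 [x1 [x01 Kx]]] : exists a b, a <= b /\ fst @` K = `[a, b]%classic.
  by apply: (@compact_convex_itv _ (R * R)%type) => // x; exact: cvg_fst.
have [X0 [X [X0X KX]]] : exists a b, a <= b /\
    (fun p => p.1 + m * p.2) @` K = `[a, b]%classic.
  apply: (@compact_convex_itv _ (R * R)%type) => //; first by continuity.
  by move=> x y t /=; rewrite /GRing.scale /=; ring.
have [|pc Kpc pcE] := image_itv_surj Ky (x := c); first by rewrite lexx.
have [|p0 Kp0 p0E] := image_itv_surj Kx (x := x0); first by rewrite lexx.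
have [|pX KpX pXE] := image_itv_surj KX (x := X); first by rewrite lexx andbT.
have c0 : 0 <= c by rewrite -pcE K_ge0.
exists c; split => //; first by exists pc.
  by move=> p /(image_itv Ky)/andP[].
rewrite (area_add_triangle m0 c0 cd cK vK Ky Kx x01 KX X0X).
have -> : shadow m K = `[x0, X]%classic.
  apply/seteqP; split => [x [p [q [Kp Kq px xq]]]|x /=].
    have /andP[x0p _] := image_itv Kx Kp; have /andP[_ qX] := image_itv KX Kq.
    by rewrite /= in_itv/= (le_trans x0p)// (le_trans xq).
  rewrite in_itv/= => /andP[x0x xX]; exists p0, pX; split => //.
    by rewrite p0E.
  by rewrite pXE.
rewrite length_itv -?EFinD//.
have /andP[_] := image_itv KX Kp0; apply: le_trans; rewrite p0E lerDl.
by apply: mulr_ge0 => //; exact: K_ge0.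
Qed.

Section sweep.
Variables (m a b : R) (S T : set 'rV[R]_3) (N : set 'rV[R]_2).
Variable psi : R -> R.
Hypotheses (m0 : 0 <= m) (ab : a <= b).
Hypothesis cS : compact S.
Hypothesis vS : convex_set (S : set (convex_lmodType 'rV[R]_3)).
Hypotheses (cT : compact T) (cN : compact N).
Hypothesis Sab : forall x t y, S (pt3 x t y) -> a <= t <= b.
Hypothesis abS : forall t, a <= t <= b -> exists x y, S (pt3 x t y).
Hypothesis S_ge0 : forall x t y, S (pt3 x t y) -> 0 <= y.
Hypothesis TE : forall t, slice T t = add_triangle m (slice S t).
Hypothesis NE : forall t, [set x | N (pt2 x t)] = shadow m (slice S t).
Hypothesis mpsi : measurable_fun `[a, b] psi.
Hypothesis psi_ge0 : forall t, a <= t <= b -> 0 <= psi t.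

Let mpsiE : measurable_fun `[a, b] (fun t => (m * psi t)%:E).
Proof. by apply/measurable_EFinP; apply: measurable_funM. Qed.

Let Tab x t y : T (pt3 x t y) -> a <= t <= b.
Proof.
move=> Txy; have : slice T t (x, y) by [].
by rewrite TE => -[u [v [_ _ _ _ /Sab]]].
Qed.

Let Nab x t : N (pt2 x t) -> a <= t <= b.
Proof.
move=> Nx; have : [set x | N (pt2 x t)] x by [].
by rewrite NE => -[p [q [/Sab]]].
Qed.

Let mN : measurable_fun `[a, b] (fun t => mu [set x | N (pt2 x t)]).
Proof.
exact: (@measurable_yfiber R (planar N) `[a, b]%classic
  (compact_measurable2 (compact_planar cN))).
Qed.

Let mshadow : measurable_fun `[a, b] (fun t => mu (shadow m (slice S t))).
Proof.
have -> : (fun t => mu (shadow m (slice S t))) =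
    (fun t => mu [set x | N (pt2 x t)]) by apply/funext => t; rewrite NE.
exact: mN.
Qed.

Let lhs : (volume T + \int[mu]_(t in `[a, b]) (m * psi t)%:E =
  \int[mu]_(t in `[a, b]) ((mu \x mu) (slice T t) + (m * psi t)%:E))%E.
Proof.
rewrite (volume_slice cT Tab) [RHS]ge0_integralD//.
- exact: measurable_slice.
- by move=> t /=; rewrite in_itv/= => tab; rewrite lee_fin mulr_ge0// psi_ge0.
Qed.

Let rhs : (volume S + (area N + (m / 2 * (b - a))%:E) =
  \int[mu]_(t in `[a, b]) ((mu \x mu) (slice S t) +
     (mu (shadow m (slice S t)) + (m / 2)%:E)))%E.
Proof.
have m2 : 0 <= m / 2 by rewrite divr_ge0.
have -> : (m / 2 * (b - a))%:E = (\int[mu]_(t in `[a, b]) (cst (m / 2)%:E t))%E.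
  by rewrite integral_cst//= EFinM length_itv.
rewrite (volume_slice cS Sab) (area_slice cN Nab).
under [in RHS]eq_integral do rewrite -NE.
rewrite -ge0_integralD// -?ge0_integralD//.
- exact: measurable_slice.
- by move=> t _; apply: adde_ge0.
- by apply: emeasurable_funD => //; exact: measurable_cst.
Qed.

Let slice_identity t : a <= t <= b -> exists c,
  [/\ 0 <= c, (exists2 p, slice S t p & p.2 = c),
     (forall p, slice S t p -> c <= p.2)
   & ((mu \x mu) (slice T t) + (m * c)%:E = (mu \x mu) (slice S t) +
       (mu (shadow m (slice S t)) + (m / 2)%:E))%E].
Proof.
move=> tab; have [x [y Sxy]] := abS tab.
have := @area_add_triangle_shadow m (slice S t) m0 (compact_slice cS)
  (convex_slice vS).
rewrite -TE; apply; first by exists (x, y).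
by move=> [x' y'] /S_ge0.
Qed.

(** [T] is the sum of [S] and a triangle in a plane where the second coordinate
    is constant, so the planar formula applies to each slice and is integrated.
    The least height of a slice enters through a comparison with an explicit
    function [psi], so that its own measurability is never needed. *)
Lemma sweep_le : (forall x t y, S (pt3 x t y) -> psi t <= y) ->
  (volume T + \int[mu]_(t in `[a, b]) (m * psi t)%:E <=
   volume S + (area N + (m / 2 * (b - a))%:E))%E.
Proof.
move=> psiS; rewrite lhs rhs; apply: ge0_le_integral => //.
- move=> t /=; rewrite in_itv/= => tab.
  by apply: adde_ge0 => //; rewrite lee_fin mulr_ge0// psi_ge0.
- by apply: emeasurable_funD => //; exact: measurable_slice.
- apply: emeasurable_funD; first exact: measurable_slice.
  by apply: emeasurable_funD.
- move=> t /=; rewrite in_itv/= => /slice_identity[c [c0 [p Sp pc] _ <-]].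
  by apply: leeD2l; rewrite lee_fin ler_wpM2l// -pc; exact: psiS Sp.
Qed.

Lemma sweep_ge :
  (forall t, a <= t <= b -> exists x y, S (pt3 x t y) /\ y <= psi t) ->
  (volume S + (area N + (m / 2 * (b - a))%:E) <=
   volume T + \int[mu]_(t in `[a, b]) (m * psi t)%:E)%E.
Proof.
move=> Spsi; rewrite lhs rhs; apply: ge0_le_integral => //.
- move=> t _; apply: adde_ge0 => //; apply: adde_ge0 => //.
  by rewrite lee_fin divr_ge0.
- apply: emeasurable_funD; first exact: measurable_slice.
  by apply: emeasurable_funD.
- by apply: emeasurable_funD => //; exact: measurable_slice.
- move=> t /=; rewrite in_itv/= => tab.
  have [c [c0 _ minc <-]] := slice_identity tab.
  have [x [y [Sxy ypsi]]] := Spsi _ tab.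
  apply: leeD2l; rewrite lee_fin ler_wpM2l// (le_trans _ ypsi)//.
  exact: (minc (x, y)).
Qed.

End sweep.

End slices.

(** * Polytopes and polarization *)

Section hulls.
Context (R : realType).

Section hull_n.
Variable n : nat.
Local Notation convex A := (convex_set (A : set (convex_lmodType 'rV[R]_n))).
Implicit Types (A B D : set 'rV[R]_n).

Lemma convex_hull_convex A : convex (convex_hull A).
Proof.
apply/convexP => x y t t0 t1 hx hy D [cD AD].
by move/convexP : (cD); apply => //; [exact: hx|exact: hy].
Qed.

Lemma sub_convex_hull A : A `<=` convex_hull A.
Proof. exact: sub_gen_smallest. Qed.

Lemma convex_hull_min A D : convex D -> A `<=` D -> convex_hull A `<=` D.
Proof. exact: smallest_sub. Qed.

Definition minkowski_sum A B : set 'rV[R]_n :=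
  [set x | exists2 a, A a & exists2 b, B b & x = a + b].

Lemma convex_minkowski_sum A B : convex A -> convex B -> convex (minkowski_sum A B).
Proof.
move=> /convexP vA /convexP vB; apply/convexP => x y t t0 t1.
move=> [a Aa [b Bb ->]] [a' Aa' [b' Bb' ->]].
exists (t *: a + (1 - t) *: a'); first exact: vA.
exists (t *: b + (1 - t) *: b'); first exact: vB.
by rewrite !scalerDr addrACA.
Qed.

Lemma minkowski_sumC A B : minkowski_sum A B = minkowski_sum B A.
Proof.
by apply/seteqP; split => x [a Aa [b Bb ->]]; exists b => //; exists a => //;
  rewrite addrC.
Qed.

End hull_n.

Lemma compact_minkowski_sum n (A B : set 'rV[R]_n) :
  compact A -> compact B -> compact (minkowski_sum A B).
Proof.
move=> cA cB; have -> : minkowski_sum A B =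
    (fun p : 'rV[R]_n * 'rV[R]_n => p.1 + p.2) @` (A `*` B).
  apply/seteqP; split => [_ [a Aa [b Bb ->]]|_ [[a b] [/= Aa Bb] <-]].
    by exists (a, b).
  by exists a => //; exists b.
apply: continuous_compact; last exact: compact_setX.
by apply: continuous_subspaceT => p; exact: add_continuous.
Qed.

(** The hull of [v :: s] is swept by the segments from [v] to the hull of [s],
    hence it is a continuous image of a product of compact sets. *)
Lemma compact_finite_hull n (s : seq 'rV[R]_n) : compact (convex_hull [set` s]).
Proof.
suff [C [cC vC sC Cmin]] : exists C : set 'rV[R]_n,
    [/\ compact C, convex_set (C : set (convex_lmodType 'rV[R]_n)),
        [set` s] `<=` C &
        forall D, convex_set (D : set (convex_lmodType 'rV[R]_n)) ->
          [set` s] `<=` D -> C `<=` D].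
  rewrite (_ : convex_hull _ = C)//; apply/seteqP; split.
    exact: convex_hull_min.
  apply: Cmin; first exact: convex_hull_convex.
  exact: sub_convex_hull.
elim: s => [|v s [C [cC vC sC Cmin]]].
  exists set0; split => //; first exact: compact0.
  by move=> D _ _ x.
have [C0|/set0P[c0 Cc0]] := eqVneq C set0.
  exists [set v]; split.
  - exact: compact_set1.
  - apply/(@convexP R 'rV[R]_n) => x y t t0 t1 /= -> ->.
    by rewrite -scalerDl addrC subrK scale1r.
  - move=> x /=; rewrite inE => /predU1P[//|xs].
    by have := sC x xs; rewrite C0.
  - by move=> D vD sD _ ->; apply: sD; rewrite /= mem_head.
exists ((fun p : R * 'rV[R]_n => p.1 *: v + (1 - p.1) *: p.2) @` (`[0, 1] `*` C)).
split.
- apply: continuous_compact; last first.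
    by apply: compact_setX => //; exact: segment_compact.
  apply: continuous_subspaceT => p.
  apply: cvgD; first by apply: cvgZr_tmp; exact: cvg_fst.
  apply: cvgZ; last exact: cvg_snd.
  by apply: cvgB; [exact: cvg_cst|exact: cvg_fst].
- apply/(@convexP R 'rV[R]_n) => _ _ t t0 t1 [[a c] [/= + Cc] <-] [[b d] [/= + Cd] <-].
  rewrite !in_itv/= => /andP[a0 a1] /andP[b0 b1].
  have [e Ce eE] : exists2 e, C e & t *: (a *: v + (1 - a) *: c) +
      (1 - t) *: (b *: v + (1 - b) *: d) =
      (t * a + (1 - t) * b) *: v + (1 - (t * a + (1 - t) * b)) *: e.
    have [E|E] := eqVneq (t * (1 - a) + (1 - t) * (1 - b)) 0.
      have E1 : t * (1 - a) = 0 by nra.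
      have E2 : (1 - t) * (1 - b) = 0 by nra.
      exists c => //; apply/rowP => j; rewrite !mxE.
      have -> : 1 - (t * a + (1 - t) * b) = t * (1 - a) + (1 - t) * (1 - b) by ring.
      rewrite E mul0r.
      have -> : t * (a * v 0 j + (1 - a) * c 0 j) + (1 - t) * (b * v 0 j + (1 - b) * d 0 j)
        = (t * a + (1 - t) * b) * v 0 j + (t * (1 - a)) * c 0 j
          + ((1 - t) * (1 - b)) * d 0 j by ring.
      by rewrite E1 E2; ring.
    have Ep : 0 < t * (1 - a) + (1 - t) * (1 - b).
      by rewrite lt_neqAle eq_sym E; nra.
    pose r := t * (1 - a) / (t * (1 - a) + (1 - t) * (1 - b)).
    exists (r *: c + (1 - r) *: d).
      move/convexP : vC; apply => //.
        by rewrite /r divr_ge0 ?(ltW Ep)//; nra.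
      by rewrite /r ler_pdivrMr// mul1r; nra.
    by apply/rowP => j; rewrite !mxE /r; field.
  rewrite eE; exists (t * a + (1 - t) * b, e) => //=; split => //.
  by rewrite in_itv/=; apply/andP; split; nra.
- move=> x /=; rewrite inE => /predU1P[->|xs].
    exists (1, c0) => /=; last by rewrite subrr scale0r addr0 scale1r.
    by split => //; rewrite in_itv/= lexx ler01.
  exists (0, x) => /=; last by rewrite subr0 scale0r add0r scale1r.
  by split; [rewrite in_itv/= lexx ler01|exact: sC].
- move=> D vD sD _ [[a c] [/= + Cc] <-]; rewrite in_itv/= => /andP[a0 a1].
  move/convexP : (vD); apply => //; first by apply: sD; rewrite /= mem_head.
  apply: (Cmin D vD _ c Cc) => x xs; apply: sD.
  by rewrite /= inE; apply/orP; right.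
Qed.

Lemma lattice_polytope_compact n (P : set 'rV[R]_n) : lattice_polytope P -> compact P.
Proof.
move=> [s _ ->].
have -> : [set map_mx (intmul 1) v | v in [set` s]] =
    [set` map (map_mx (intmul (1 : R))) s].
  apply/seteqP; split => [_ [v vs <-]|_ /mapP[v vs ->]].
    by rewrite /=; apply/mapP; exists v.
  by exists v.
exact: compact_finite_hull.
Qed.

Lemma lattice_polytope_convex n (P : set 'rV[R]_n) : lattice_polytope P ->
  convex_set (P : set (convex_lmodType 'rV[R]_n)).
Proof. by move=> [s _ ->]; exact: convex_hull_convex. Qed.

End hulls.

Section mixed_volumes.
Context (R : realType).

Lemma sum_ffun2 (l : nat) (F : 'I_l -> 'I_l -> R) :
  \sum_(i : {ffun 'I_2 -> 'I_l}) F (i 0) (i 1) = \sum_a \sum_b F a b.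
Proof.
rewrite pair_bigA/=.
rewrite (reindex (fun p : 'I_l * 'I_l => [ffun k : 'I_2 => tnth [tuple p.1; p.2] k])).
  by apply: eq_bigr => p _; rewrite !ffunE.
exists (fun i : {ffun 'I_2 -> 'I_l} => (i 0, i 1)).
  by move=> [a b] _; rewrite !ffunE.
move=> i _; apply/ffunP => -[[|[|k]] Hk]//; rewrite ffunE /=;
  by congr (i _); apply/val_inj.
Qed.

Lemma sum_ffun3 (l : nat) (F : 'I_l -> 'I_l -> 'I_l -> R) :
  \sum_(i : {ffun 'I_3 -> 'I_l}) F (i 0) (i 1) (i 2) = \sum_a \sum_b \sum_c F a b c.
Proof.
have -> : \sum_a \sum_b \sum_c F a b c = \sum_a \sum_(p : 'I_l * 'I_l) F a p.1 p.2.
  by apply: eq_bigr => a _; rewrite pair_bigA.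
rewrite pair_bigA/=.
rewrite (reindex (fun p : 'I_l * ('I_l * 'I_l) =>
   [ffun k : 'I_3 => tnth [tuple p.1; p.2.1; p.2.2] k])).
  by apply: eq_bigr => p _; rewrite !ffunE.
exists (fun i : {ffun 'I_3 -> 'I_l} => (i 0, (i 1, i 2))).
  by move=> [a [b c]] _; rewrite !ffunE.
move=> i _; apply/ffunP => -[[|[|[|k]]] Hk]//; rewrite ffunE /=;
  by congr (i _); apply/val_inj.
Qed.

Section expansion.
Variables (n : nat) (vol : set 'rV[R]_n -> \bar R) (MV : n.-tuple (set 'rV[R]_n) -> R).
Hypothesis hMV : is_mixed_volume vol MV.

Lemma minkowski_comb1 (A : set 'rV[R]_n) :
  minkowski_comb (fun=> 1) (tnth [tuple A]) = A.
Proof.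
apply/seteqP; split => [x [v vA ->]|x Ax].
  by rewrite big_ord1 scale1r; exact: (vA ord0).
by exists (fun=> x); [case=> -[]|rewrite big_ord1 scale1r].
Qed.

Lemma minkowski_comb2 (A B : set 'rV[R]_n) :
  minkowski_comb (fun=> 1) (tnth [tuple A; B]) = minkowski_sum A B.
Proof.
apply/seteqP; split => [x [v vA ->]|_ [a Aa [b Bb ->]]].
  exists (v 0); first exact: (vA 0).
  by exists (v 1); [exact: (vA 1)|rewrite !big_ord_recl big_ord0 !scale1r addr0;
    congr (_ + v _); apply/val_inj].
exists (tnth [tuple a; b]); first by case=> -[|[]].
by rewrite !big_ord_recl big_ord0 !scale1r addr0.
Qed.

Lemma minkowski_comb3 (A B C : set 'rV[R]_n) :
  minkowski_comb (fun=> 1) (tnth [tuple A; B; C]) = minkowski_sum (minkowski_sum A B) C.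
Proof.
apply/seteqP; split => [x [v vA ->]|_ [_ [a Aa [b Bb ->]] [c Cc ->]]].
  exists (v 0 + v 1).
    by exists (v 0); [exact: (vA 0)|exists (v 1); [exact: (vA 1)|]].
  exists (v 2); first exact: (vA 2).
  rewrite !big_ord_recl big_ord0 !scale1r addr0 addrA.
  by congr (_ + v _ + v _); apply/val_inj.
exists (tnth [tuple a; b; c]); first by case=> -[|[|[]]].
by rewrite !big_ord_recl big_ord0 !scale1r addr0 addrA.
Qed.

Lemma mixed_volume_sum (l : nat) (P : 'I_l -> set 'rV[R]_n) : (0 < l)%N ->
  (forall i, lattice_polytope (P i)) ->
  vol (minkowski_comb (fun=> 1) P) =
  (\sum_(i : {ffun 'I_n -> 'I_l}) MV [tuple P (i k) | k < n])%:E.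
Proof.
move=> l0 lP; rewrite hMV.2//; congr (_%:E); apply: eq_bigr => i _.
by rewrite big1_eq mul1r.
Qed.

End expansion.

Lemma mixed_area_polarization (vol : set 'rV[R]_2 -> \bar R) MV A B :
  is_mixed_volume vol MV -> lattice_polytope A -> lattice_polytope B ->
  exists a b : R, [/\ vol A = a%:E, vol B = b%:E &
    vol (minkowski_sum A B) = (a + b + 2 * MV [tuple A; B])%:E].
Proof.
move=> hMV lA lB.
have tE l (P : 'I_l -> set 'rV[R]_2) (i : {ffun 'I_2 -> 'I_l}) :
    [tuple P (i k) | k < 2] = [tuple P (i 0); P (i 1)].
  by apply: eq_from_tnth => -[[|[|k]] Hk]//; rewrite tnth_mktuple /=;
    congr (P (i _)); apply/val_inj.
have E (l : nat) (P : 'I_l -> set 'rV[R]_2) : (0 < l)%N ->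
    (forall i, lattice_polytope (P i)) ->
    vol (minkowski_comb (fun=> 1) P) = (\sum_a \sum_b MV [tuple P a; P b])%:E.
  move=> l0 lP; rewrite (mixed_volume_sum hMV)//; congr (_%:E).
  rewrite -(sum_ffun2 (fun a b => MV [tuple P a; P b])).
  by apply: eq_bigr => i _; rewrite tE.
have S : MV [tuple B; A] = MV [tuple A; B].
  rewrite -(hMV.1 [tuple A; B] (tperm 0 1)).
    congr MV; apply: eq_from_tnth => -[[|[|k]] Hk]//; rewrite tnth_mktuple.
      by rewrite (_ : Ordinal _ = 0) ?tpermL//; exact/val_inj.
    by rewrite (_ : Ordinal _ = 1) ?tpermR//; exact/val_inj.
  by case=> -[|[|]].
exists (MV [tuple A; A]), (MV [tuple B; B]); split.
- rewrite -[X in vol X]minkowski_comb1 E//; first by rewrite !big_ord1.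
  by case=> -[].
- rewrite -[X in vol X]minkowski_comb1 E//; first by rewrite !big_ord1.
  by case=> -[].
- rewrite -minkowski_comb2 E//; last by case=> -[|[]].
  rewrite !big_ord_recl !big_ord0 /= (tnth_nth set0) /=.
  congr (_%:E); rewrite !(tnth_nth set0)/= S; ring.
Qed.

(** In the expansion of the volume of the triple sum, the terms that omit one of
    the bodies are those of the partial sums; inclusion and exclusion leaves the
    six orderings of [A], [B], [C]. *)
Lemma mixed_volume_polarization (vol : set 'rV[R]_3 -> \bar R) MV A B C :
  is_mixed_volume vol MV ->
  lattice_polytope A -> lattice_polytope B -> lattice_polytope C ->
  exists a b c ab ac bc : R,
   [/\ [/\ vol A = a%:E, vol B = b%:E & vol C = c%:E],
       [/\ vol (minkowski_sum A B) = ab%:E, vol (minkowski_sum A C) = ac%:E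
         & vol (minkowski_sum B C) = bc%:E] &
    vol (minkowski_sum (minkowski_sum A B) C) =
      (ab + ac + bc - a - b - c + 6 * MV [tuple A; B; C])%:E].
Proof.
move=> hMV lA lB lC.
have tE l (P : 'I_l -> set 'rV[R]_3) (i : {ffun 'I_3 -> 'I_l}) :
    [tuple P (i k) | k < 3] = [tuple P (i 0); P (i 1); P (i 2)].
  by apply: eq_from_tnth => -[[|[|[|k]]] Hk]//; rewrite tnth_mktuple /=;
    congr (P (i _)); apply/val_inj.
have E (l : nat) (P : 'I_l -> set 'rV[R]_3) : (0 < l)%N ->
    (forall i, lattice_polytope (P i)) ->
    vol (minkowski_comb (fun=> 1) P) =
    (\sum_a \sum_b \sum_c MV [tuple P a; P b; P c])%:E.
  move=> l0 lP; rewrite (mixed_volume_sum hMV)//; congr (_%:E).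
  rewrite -(sum_ffun3 (fun a b c => MV [tuple P a; P b; P c])).
  by apply: eq_bigr => i _; rewrite tE.
have S01 X Y Z : lattice_polytope X -> lattice_polytope Y -> lattice_polytope Z ->
    MV [tuple Y; X; Z] = MV [tuple X; Y; Z].
  move=> lX lY lZ; rewrite -(hMV.1 [tuple X; Y; Z] (tperm 0 1)).
    congr MV; apply: eq_from_tnth => -[[|[|[|k]]] Hk]//; rewrite tnth_mktuple.
    - by rewrite (_ : Ordinal _ = 0) ?tpermL//; exact/val_inj.
    - by rewrite (_ : Ordinal _ = 1) ?tpermR//; exact/val_inj.
    - by rewrite (_ : Ordinal _ = 2) ?tpermD//; exact/val_inj.
  by case=> -[|[|[|]]].
have S12 X Y Z : lattice_polytope X -> lattice_polytope Y -> lattice_polytope Z ->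
    MV [tuple X; Z; Y] = MV [tuple X; Y; Z].
  move=> lX lY lZ; rewrite -(hMV.1 [tuple X; Y; Z] (tperm 1 2)).
    congr MV; apply: eq_from_tnth => -[[|[|[|k]]] Hk]//; rewrite tnth_mktuple.
    - by rewrite (_ : Ordinal _ = 0) ?tpermD//; exact/val_inj.
    - by rewrite (_ : Ordinal _ = 1) ?tpermL//; exact/val_inj.
    - by rewrite (_ : Ordinal _ = 2) ?tpermR//; exact/val_inj.
  by case=> -[|[|[|]]].
have E1 X : lattice_polytope X -> vol X = (MV [tuple X; X; X])%:E.
  move=> lX; rewrite -[X in vol X]minkowski_comb1 E//; first by rewrite !big_ord1.
  by case=> -[].
have E2 X Y : lattice_polytope X -> lattice_polytope Y -> vol (minkowski_sum X Y) =
    (MV [tuple X; X; X] + 3 * MV [tuple X; X; Y] + 3 * MV [tuple X; Y; Y]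
     + MV [tuple Y; Y; Y])%:E.
  move=> lX lY; rewrite -minkowski_comb2 E//; last by case=> -[|[]].
  rewrite !big_ord_recl !big_ord0 /= !(tnth_nth set0)/=.
  rewrite (S12 X X Y)// (S01 X Y X)// (S12 X X Y)// (S01 X Y Y)// (S12 Y X Y)//.
  by rewrite (S01 X Y Y)//; congr (_%:E); ring.
rewrite (E1 A)// (E1 B)// (E1 C)// (E2 A B)// (E2 A C)// (E2 B C)//.
do 6 eexists; split; [split; reflexivity|split; reflexivity|].
rewrite -minkowski_comb3 E//; last by case=> -[|[|[]]].
rewrite !big_ord_recl !big_ord0 /= !(tnth_nth set0)/=; congr (_%:E).
have s1 X Y : lattice_polytope X -> lattice_polytope Y ->
   MV [tuple X; Y; X] = MV [tuple X; X; Y] by move=> *; rewrite S12.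
have s2 X Y : lattice_polytope X -> lattice_polytope Y ->
   MV [tuple Y; X; X] = MV [tuple X; X; Y] by move=> *; rewrite S01// s1.
rewrite (S12 A B C)// (S01 A B C)// (S01 A C B)// (S12 B A C)// (S01 A B C)//.
rewrite (S12 A B C)// (S12 C A B)// (S01 A C B)// (S12 A B C)//.
rewrite (s1 A B)// (s1 A C)// (s1 B A)// (s1 B C)// (s1 C A)// (s1 C B)//.
rewrite (s2 A B)// (s2 A C)// (s2 B A)// (s2 B C)// (s2 C A)// (s2 C B)//.
ring.
Qed.

End mixed_volumes.

(** * Shadows and profiles *)

Section geometry.
Context (R : realType).
Local Notation mu := (@lebesgue_measure R).
Local Notation convex3 S := (convex_set (S : set (convex_lmodType 'rV[R]_3))).
Local Notation convex2 S := (convex_set (S : set (convex_lmodType 'rV[R]_2))).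
Local Notation area N := ((mu \x mu)%E (planar N)).
Local Notation volume S := (((mu \x mu) \x mu)%E (spatial S)).
Implicit Types (S P Q : set 'rV[R]_3) (N : set 'rV[R]_2).

(** The polygon swept by the shadows of the slices. *)
Definition solid_shadow (m : R) S : set 'rV[R]_2 :=
  [set v | shadow m (slice S (v 0 1)) (v 0 0)].

Lemma solid_shadowP m S x t : solid_shadow m S (pt2 x t) <-> shadow m (slice S t) x.
Proof. by rewrite /solid_shadow/= !mxE. Qed.

Lemma convex3P S : convex3 S <-> forall x y z x' y' z' t, 0 <= t -> t <= 1 ->
  S (pt3 x y z) -> S (pt3 x' y' z') ->
  S (pt3 (t * x + (1 - t) * x') (t * y + (1 - t) * y') (t * z + (1 - t) * z')).
Proof.
split => [/convexP vS x y z x' y' z' t t0 t1 S1 S2|vS].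
  by rewrite -pt3_conv; exact: vS.
apply/(@convexP R 'rV[R]_3) => v w t t0 t1.
by rewrite (pt3_eta v) (pt3_eta w) pt3_conv; exact: vS.
Qed.

Lemma convex_rV2P N : convex2 N <-> forall x y x' y' t, 0 <= t -> t <= 1 ->
  N (pt2 x y) -> N (pt2 x' y') ->
  N (pt2 (t * x + (1 - t) * x') (t * y + (1 - t) * y')).
Proof.
split => [/convexP vS x y x' y' t t0 t1 S1 S2|vS].
  by rewrite -pt2_conv; exact: vS.
apply/(@convexP R 'rV[R]_2) => v w t t0 t1.
by rewrite (pt2_eta v) (pt2_eta w) pt2_conv; exact: vS.
Qed.

Lemma convex_solid_shadow (m : R) S : convex3 S -> convex2 (solid_shadow m S).
Proof.
move=> /convex3P vS; apply/convex_rV2P => x t x' t' s s0 s1.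
move=> /solid_shadowP [[p1 p2] [[q1 q2] /= [Sp Sq px xq]]].
move=> /solid_shadowP [[p1' p2'] [[q1' q2'] /= [Sp' Sq' px' xq']]].
apply/solid_shadowP; exists (s * p1 + (1 - s) * p1', s * p2 + (1 - s) * p2').
exists (s * q1 + (1 - s) * q1', s * q2 + (1 - s) * q2'); split => /=.
- exact: vS Sp Sp'.
- exact: vS Sq Sq'.
- by apply: lerD; apply: ler_wpM2l => //; rewrite subr_ge0.
- have -> : s * q1 + (1 - s) * q1' + m * (s * q2 + (1 - s) * q2') =
    s * (q1 + m * q2) + (1 - s) * (q1' + m * q2') by ring.
  by apply: lerD; apply: ler_wpM2l => //; rewrite subr_ge0.
Qed.

Lemma solid_shadow_pt (m : R) S x t y : 0 <= m -> 0 <= y -> S (pt3 x t y) ->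
  solid_shadow m S (pt2 x t) /\ solid_shadow m S (pt2 (x + m * y) t).
Proof.
move=> m0 y0 Sxty.
by split; apply/solid_shadowP; exists (x, y), (x, y); split => //=;
  rewrite lerDl mulr_ge0.
Qed.

Lemma minkowski_pt3 S P x t y : minkowski_sum S P (pt3 x t y) <->
  exists x1 t1 y1 x2 t2 y2, [/\ S (pt3 x1 t1 y1), P (pt3 x2 t2 y2),
    x = x1 + x2, t = t1 + t2 & y = y1 + y2].
Proof.
split => [[a Sa [b Pb E]]|[x1 [t1 [y1 [x2 [t2 [y2 [S1 P2 -> -> ->]]]]]]]].
  exists (a 0 0), (a 0 1), (a 0 2), (b 0 0), (b 0 1), (b 0 2).
  rewrite -!pt3_eta; split => //.
  - by have := congr1 (fun v : 'rV[R]_3 => v 0 0) E; rewrite /= !mxE.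
  - by have := congr1 (fun v : 'rV[R]_3 => v 0 1) E; rewrite /= !mxE.
  - by have := congr1 (fun v : 'rV[R]_3 => v 0 2) E; rewrite /= !mxE.
by exists (pt3 x1 t1 y1) => //; exists (pt3 x2 t2 y2) => //; rewrite pt3_add.
Qed.

Lemma minkowski_pt2 (N N' : set 'rV[R]_2) x t : minkowski_sum N N' (pt2 x t) <->
  exists x1 t1 x2 t2, [/\ N (pt2 x1 t1), N' (pt2 x2 t2),
    x = x1 + x2 & t = t1 + t2].
Proof.
split => [[a Sa [b Pb E]]|[x1 [t1 [x2 [t2 [S1 P2 -> ->]]]]]].
  exists (a 0 0), (a 0 1), (b 0 0), (b 0 1).
  rewrite -!pt2_eta; split => //.
  - by have := congr1 (fun v : 'rV[R]_2 => v 0 0) E; rewrite /= !mxE.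
  - by have := congr1 (fun v : 'rV[R]_2 => v 0 1) E; rewrite /= !mxE.
by exists (pt2 x1 t1) => //; exists (pt2 x2 t2) => //; rewrite pt2_add.
Qed.

Lemma between_convex2 N (x1 x x2 t : R) : convex2 N ->
  N (pt2 x1 t) -> N (pt2 x2 t) -> x1 <= x -> x <= x2 -> N (pt2 x t).
Proof.
move=> /convex_rV2P vN N1 N2 x1x xx2.
have [E|E] := eqVneq x1 x2.
  by rewrite (_ : x = x1)//; apply/eqP; rewrite eq_le x1x E xx2.
have d0 : 0 < x2 - x1 by rewrite subr_gt0 lt_neqAle E (le_trans x1x).
have := vN _ _ _ _ ((x2 - x) / (x2 - x1)) _ _ N1 N2.
have -> : (x2 - x) / (x2 - x1) * x1 + (1 - (x2 - x) / (x2 - x1)) * x2 = x.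
  by field; rewrite gt_eqF.
have -> : (x2 - x) / (x2 - x1) * t + (1 - (x2 - x) / (x2 - x1)) * t = t by ring.
apply; first by rewrite divr_ge0 ?(ltW d0)// subr_ge0.
by rewrite ler_pdivrMr// mul1r lerB.
Qed.

(** A shadow is spanned by two linear projections, [x] and [x + m * y], of the
    slice; both commute with sums, and a sum of convex sets contains the segments
    between its points. *)
Lemma solid_shadow_minkowski_sum (m : R) S P : 0 <= m -> convex3 S -> convex3 P ->
  (forall x t y, S (pt3 x t y) -> 0 <= y) ->
  (forall x t y, P (pt3 x t y) -> 0 <= y) ->
  solid_shadow m (minkowski_sum S P) = minkowski_sum (solid_shadow m S) (solid_shadow m P).
Proof.
move=> m0 vS vP S0 P0; apply/seteqP; split => v; rewrite (pt2_eta v).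
  move: (v 0 0) (v 0 1) => {v} x t /solid_shadowP[[a1 a2] [[b1 b2] /= []]].
  move=> /minkowski_pt3[x1 [t1 [y1 [x2 [t2 [y2 [S1 P2 /= -> tE a2E]]]]]]].
  move=> /minkowski_pt3[x3 [t3 [y3 [x4 [t4 [y4 [S3 P4 /= -> tE' ->]]]]]]] ax xb.
  apply: (@between_convex2 _ (x1 + x2) _ (x3 + x4 + m * (y3 + y4))) => //.
  - by apply: convex_minkowski_sum; exact: convex_solid_shadow.
  - apply/minkowski_pt2; exists x1, t1, x2, t2; split => //.
      by have [] := solid_shadow_pt m0 (S0 _ _ _ S1) S1.
    by have [] := solid_shadow_pt m0 (P0 _ _ _ P2) P2.
  - apply/minkowski_pt2; exists (x3 + m * y3), t3, (x4 + m * y4), t4; split => //.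
    + by have [] := solid_shadow_pt m0 (S0 _ _ _ S3) S3.
    + by have [] := solid_shadow_pt m0 (P0 _ _ _ P4) P4.
    + ring.
move: (v 0 0) (v 0 1) => {v} x t /minkowski_pt2[x1 [t1 [x2 [t2 []]]]].
move=> /solid_shadowP[[p1 p2] [[q1 q2] /= [Sp Sq px xq]]].
move=> /solid_shadowP[[p1' p2'] [[q1' q2'] /= [Sp' Sq' px' xq']]] -> ->.
apply/solid_shadowP; exists (p1 + p1', p2 + p2'), (q1 + q1', q2 + q2'); split => /=.
- by apply/minkowski_pt3; exists p1, t1, p2, p1', t2, p2'.
- by apply/minkowski_pt3; exists q1, t1, q2, q1', t2, q2'.
- exact: lerD.
- by rewrite mulrDr addrACA lerD.
Qed.

Definition is_triangle (m : R) Q := forall u w v,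
  Q (pt3 u w v) <-> [/\ w = 0, 0 <= v, v <= 1, 0 <= u & u <= m * (1 - v)].

Lemma slice_minkowski_sum_triangle (m : R) S Q t : is_triangle m Q ->
  slice (minkowski_sum S Q) t = add_triangle m (slice S t).
Proof.
move=> QE; apply/seteqP; split => [[x y]|[x y]].
  move=> /minkowski_pt3[x1 [t1 [y1 [u [w [v [S1 /QE[-> v0 v1 u0 um] /= -> -> ->]]]]]]].
  by exists u, v; split => //; rewrite /slice/= !addrK addr0.
move=> [u [v [v0 v1 u0 um Sxy]]]; apply/minkowski_pt3.
exists (x - u), t, (y - v), u, 0, v; split => //=; rewrite ?subrK ?addr0//.
exact/QE.
Qed.

Lemma volume_triangle (m : R) Q : compact Q -> is_triangle m Q -> volume Q = 0%E.
Proof.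
move=> cQ QE; rewrite (@volume_slice _ _ 0 0)//; last first.
  by move=> x t y /QE[-> *]; rewrite lexx.
by rewrite set_itv1 integral_set1.
Qed.

(** What determines the lower boundary of the projection of a solid to the
    [(t, y)] plane: it joins (0, 1), [(s, 0)] and [(d, 0)], or it is only the
    point (0, 1), encoded by [s = d = 0]. *)
Record profile S (s d : R) : Prop := Profile {
  profile_box : forall x t y, S (pt3 x t y) ->
     [/\ 0 <= t, t <= d, 0 <= y & y <= 1];
  profile_above : forall x t y, S (pt3 x t y) -> s * (1 - y) <= t;
  profile_top : exists x, S (pt3 x 0 1);
  profile_cases : [/\ s = 0, d = 0 & forall x t y, S (pt3 x t y) -> y = 1] \/
     [/\ 1 <= s, s <= d, exists x, S (pt3 x s 0) & exists x, S (pt3 x d 0)] }.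

Lemma profile_le S s d : profile S s d -> 0 <= s <= d.
Proof.
by move=> [_ _ _ [[-> -> _]|[s1 sd _ _]]]; rewrite ?lexx// sd andbT (le_trans _ s1).
Qed.

(** The lower boundary determined by a profile.  For [s = 0] the convention
    [t / 0 = 0] gives the height 1 of the point (0, 1). *)
Definition ramp (s : R) : R -> R := (fun t => 1 - t / s) \_ `[0, s].

Lemma ramp_ge0 s t : 0 <= ramp s t.
Proof.
rewrite /ramp patchE; case: ifPn => //; rewrite inE/= in_itv/= => /andP[t0 ts].
have [->|s0] := eqVneq s 0; first by rewrite invr0 mulr0 subr0.
have sp : 0 < s by rewrite lt_neqAle eq_sym s0 (le_trans t0).
by rewrite subr_ge0 ler_pdivrMr// mul1r.
Qed.

Lemma profile_ramp S s d t : convex3 S -> profile S s d -> 0 <= t <= d ->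
  exists x y, S (pt3 x t y) /\ y <= ramp s t.
Proof.
move=> /convex3P vS [_ _ [x0 S0]]; case.
  move=> [-> -> _] /andP[t0 t1]; have -> : t = 0 by apply/eqP; rewrite eq_le t0 t1.
  exists x0, 1; split => //.
  by rewrite /ramp patchE mem_set/= ?in_itv/= ?lexx// mul0r subr0.
move=> [s1 sd [xs Ss] [xd Sd]] /andP[t0 td].
have s0 : 0 < s by rewrite (lt_le_trans _ s1).
have [ts|st] := leP t s.
  exists (t / s * xs + (1 - t / s) * x0), (1 - t / s); split; last first.
    by rewrite /ramp patchE mem_set//= in_itv/= t0.
  have := vS _ _ _ _ _ _ (t / s) _ _ Ss S0.
  have -> : t / s * s + (1 - t / s) * 0 = t by field; rewrite gt_eqF.
  have -> : t / s * 0 + (1 - t / s) * 1 = 1 - t / s by ring.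
  by apply; [rewrite divr_ge0// ltW|rewrite ler_pdivrMr// mul1r].
have ds : 0 < d - s by rewrite subr_gt0 (lt_le_trans st).
exists ((d - t) / (d - s) * xs + (1 - (d - t) / (d - s)) * xd), 0; split; last exact: ramp_ge0.
have := vS _ _ _ _ _ _ ((d - t) / (d - s)) _ _ Ss Sd.
have -> : (d - t) / (d - s) * s + (1 - (d - t) / (d - s)) * d = t.
  by field; rewrite gt_eqF.
have -> : (d - t) / (d - s) * 0 + (1 - (d - t) / (d - s)) * 0 = 0 :> R by ring.
apply; first by rewrite divr_ge0 ?(ltW ds)// subr_ge0.
by rewrite ler_pdivrMr// mul1r lerB// ltW.
Qed.

Lemma measurable_patch (A D : set R) (f : R -> R) : measurable A ->
  measurable_fun setT f -> measurable_fun D (f \_ A).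
Proof.
move=> mA mf; apply: measurable_funTS; apply/(measurable_restrictT f mA).
exact: measurable_funTS.
Qed.

Lemma integral_patch (a b m : R) (A : set R) (f : R -> R) :
  A `<=` `[a, b] ->
  (\int[mu]_(t in `[a, b]) (m * (f \_ A) t)%:E)%E =
  (\int[mu]_(t in A) (m * f t)%:E)%E.
Proof.
move=> Aab; rewrite -[in RHS](setIidr Aab) integral_mkcondr.
apply: eq_integral => t _; rewrite !patchE; case: ifPn => // _.
by rewrite mulr0.
Qed.

Lemma integral_ramp (m s d : R) : 0 <= s <= d ->
  (\int[mu]_(t in `[0%R, d]) (m * ramp s t)%:E)%E = (m * (s / 2))%:E.
Proof.
move=> /andP[s0 sd]; rewrite /ramp integral_patch; last first.
  by move=> t /=; rewrite !in_itv/= => /andP[-> /le_trans]; exact.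
have -> : (fun t : R => (m * (1 - t / s))%:E) = (fun t => (m + (- m / s) * t)%:E).
  by apply/funext => t; congr (_%:E); ring.
rewrite integral_affine//; congr (_%:E).
have [->|sn0] := eqVneq s 0; first by rewrite !mul0r !subrr !mulr0 mul0r mulr0 addr0.
by field.
Qed.

(** The lower boundary of the sum of two solids with parameters [s <= r]: the
    steeper edge comes first.  The second edge is only followed up to [s + w]. *)
Definition ramp2 (s r w : R) : R -> R := fun t =>
  ((fun t => 2 - t / s) \_ `[0, s]) t +
  ((fun t => 1 - (t - s) / r) \_ `]s, s + w]) t.

Section ramp2.
Variables (s r w : R).
Hypotheses (s_gt0 : 0 < s) (sr : s <= r) (w_ge0 : 0 <= w) (wr : w <= r).

Let r_gt0 : 0 < r. Proof. exact: lt_le_trans sr. Qed.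

Lemma ramp2_ge0 t : 0 <= ramp2 s r w t.
Proof.
move: (s_gt0) (sr) (w_ge0) (wr) (r_gt0) => s0 sr0 w0 wr0 r0.
apply: addr_ge0; rewrite patchE; case: ifPn => //; rewrite inE/= in_itv/= => /andP[t0 ts].
  by rewrite subr_ge0 ler_pdivrMr//; lra.
by rewrite subr_ge0 ler_pdivrMr//; lra.
Qed.

Lemma ramp2_le t1 y1 t2 y2 : 0 <= y1 -> y1 <= 1 -> 0 <= y2 -> y2 <= 1 ->
  s * (1 - y1) <= t1 -> r * (1 - y2) <= t2 ->
  ramp2 s r w (t1 + t2) <= y1 + y2.
Proof.
move: (s_gt0) (sr) (w_ge0) (wr) (r_gt0) => s0 sr0 w0 wr0 r0.
move=> y10 y11 y20 y21 h1 h2.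
have inI (i : interval R) : (t1 + t2 \in [set` i]) = (t1 + t2 \in i).
  by apply/idP/idP => [/set_mem//|?]; exact/mem_set.
rewrite /ramp2 !patchE !inI !in_itv/= -[point]/(0 : R).
have sy1 : s * y1 <= r * y1 by exact: ler_wpM2r.
have sy2 : s * (1 - y2) <= r * (1 - y2) by apply: ler_wpM2r => //; lra.
have t10 : 0 <= t1 by apply: le_trans h1; apply: mulr_ge0; lra.
have t20 : 0 <= t2 by apply: le_trans h2; apply: mulr_ge0; lra.
have [ts|ts] := leP (t1 + t2) s; rewrite ?andbT ?andbF/=.
  rewrite ifT; last by lra.
  rewrite addr0 lerBlDr -lerBlDl ler_pdivlMr//; nra.
rewrite add0r; case: ifPn => _; last by lra.
rewrite lerBlDr -lerBlDl ler_pdivlMr//; nra.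
Qed.

Lemma measurable_ramp2 (D : set R) : measurable_fun D (ramp2 s r w).
Proof.
apply: measurable_funD; apply: measurable_patch => //.
  have -> : (fun t : R => 2 - t / s) = (fun t => 2 + (- s^-1) * t).
    by apply/funext => t; ring.
  exact: measurable_affine.
have -> : (fun t : R => 1 - (t - s) / r) = (fun t => (1 + s / r) + (- r^-1) * t).
  by apply/funext => t; ring.
exact: measurable_affine.
Qed.

Lemma integral_ramp2 (m D : R) : 0 <= m -> s + w <= D ->
  (\int[mu]_(t in `[0%R, D]) (m * ramp2 s r w t)%:E)%E =
  (m * (3 * s / 2 + w - w ^+ 2 / (2 * r)))%:E.
Proof.
move: (s_gt0) (sr) (w_ge0) (wr) (r_gt0) => s0 sr0 w0 wr0 r0.
move=> m0 swD.
pose f1 := (fun t : R => 2 - t / s) \_ `[0, s].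
pose f2 := (fun t : R => 1 - (t - s) / r) \_ `]s, s + w].
have -> : (fun t : R => (m * ramp2 s r w t)%:E) =
    (fun t => (m * f1 t)%:E + (m * f2 t)%:E)%E.
  by apply/funext => t; rewrite -EFinD -mulrDr.
have E1 : (fun t : R => 2 - t / s) = (fun t => 2 + (- s^-1) * t).
  by apply/funext => t; ring.
have E2 : (fun t : R => 1 - (t - s) / r) = (fun t => (1 + s / r) + (- r^-1) * t).
  by apply/funext => t; ring.
have mf1 : measurable_fun `[0, D] f1.
  by apply: measurable_patch => //; rewrite E1; exact: measurable_affine.
have mf2 : measurable_fun `[0, D] f2.
  by apply: measurable_patch => //; rewrite E2; exact: measurable_affine.
have f1_ge0 t : 0 <= f1 t.
  rewrite /f1 patchE; case: ifPn => //; rewrite inE/= in_itv/= => /andP[t0 ts].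
  by rewrite subr_ge0 ler_pdivrMr//; lra.
have f2_ge0 t : 0 <= f2 t.
  rewrite /f2 patchE; case: ifPn => //; rewrite inE/= in_itv/= => /andP[t0 ts].
  by rewrite subr_ge0 ler_pdivrMr//; lra.
rewrite ge0_integralD//; first last.
- by apply/measurable_EFinP; apply: measurable_funM.
- by move=> t _; rewrite lee_fin mulr_ge0.
- by apply/measurable_EFinP; apply: measurable_funM.
- by move=> t _; rewrite lee_fin mulr_ge0.
rewrite !integral_patch; first last.
- by move=> t /=; rewrite !in_itv/= => /andP[t0 ts]; apply/andP; split; lra.
- by move=> t /=; rewrite !in_itv/= => /andP[t0 ts]; apply/andP; split; lra.
have -> : (fun t : R => (m * (2 - t / s))%:E) = (fun t => (2 * m + (- m / s) * t)%:E).
  by apply/funext => t; congr (_%:E); ring.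
have -> : (fun t : R => (m * (1 - (t - s) / r))%:E) =
    (fun t => (m + m * s / r + (- m / r) * t)%:E).
  by apply/funext => t; congr (_%:E); ring.
rewrite integral_itv_obnd_cbnd; last first.
  by apply/measurable_EFinP; exact: measurable_affine.
rewrite integral_affine ?(ltW s0)// integral_affine ?lerDl//.
rewrite -EFinD; congr (_%:E).
by field; rewrite !gt_eqF.
Qed.

End ramp2.

(** Below the lower boundary of the sum lie, side by side, a rectangle of width
    [s1] and height 1 that carries the triangle below the first boundary, and the
    triangle below the second one (for [0 < s1 <= s2]).  If the second solid
    projects to a point, the sum is the first hull moved up by one, and its part
    over [[0, s1]] is already enough: this is [ramp2] with [w = 0]. *)
Lemma profile_joint (m : R) S1 S2 s1 d1 s2 d2 : 0 <= m ->
  profile S1 s1 d1 -> profile S2 s2 d2 -> s1 != 0 \/ s2 != 0 ->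
  exists psi : R -> R, [/\ forall t, 0 <= psi t,
    measurable_fun `[0, d1 + d2] psi,
    (forall x t y, minkowski_sum S1 S2 (pt3 x t y) -> psi t <= y) &
    exists2 J, (\int[mu]_(t in `[0%R, (d1 + d2)%R]) (m * psi t)%:E)%E = (m * J)%:E &
      s1 / 2 + s2 / 2 + 1 <= J].
Proof.
move=> m0; wlog : S1 S2 s1 s2 d1 d2 / s1 <> 0 /\ (s2 = 0 \/ s1 <= s2).
  move=> H pr1 pr2 s12.
  have [s120|s12'] := pselect (s1 <> 0 /\ (s2 = 0 \/ s1 <= s2)); first exact: H.
  rewrite addrC minkowski_sumC [s1 / 2 + _]addrC; apply: H => //;
    last by case: s12; [right|left].
  have [E|E] := eqVneq s1 0.
    by case: s12; [rewrite E eqxx|move=> /eqP s20; split => //; left].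
  have [E2|/eqP E2] := eqVneq s2 0; first by exfalso; apply: s12'; split; [exact/eqP|left].
  split => //; right; case: (leP s2 s1) => // /ltW lt12.
  by exfalso; apply: s12'; split; [exact/eqP|right].
move=> [s10 s12] pr1 pr2 _.
have s11 : 1 <= s1 /\ s1 <= d1.
  by have [_ _ _ [[]|[]]] := pr1.
have s1p : 0 < s1 by lra.
have box1 := profile_box pr1; have box2 := profile_box pr2.
have [s20|s20] := pselect (s2 = 0).
  have [_ _ _ [[_ d20 y1]|[]]] := pr2; last by rewrite s20 ler10.
  exists (ramp2 s1 s1 0); split.
  - by move=> t; apply: ramp2_ge0 => //; exact: ltW.
  - exact: measurable_ramp2.
  - move=> x t y /minkowski_pt3[x1 [t1 [y1' [x2 [t2 [y2 [S1x S2x _ -> ->]]]]]]].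
    have [? ? ? ?] := box1 _ _ _ S1x; have [? ? ? ?] := box2 _ _ _ S2x.
    apply: ramp2_le; rewrite ?(ltW s1p)//; first exact: (profile_above pr1) S1x.
    by rewrite (y1 _ _ _ S2x) subrr mulr0.
  - eexists; first by apply: integral_ramp2 => //; lra.
    by rewrite s20 expr0n/= mul0r; lra.
have [_ _ _ [[]//|[s21 sd2 _ _]]] := pr2.
have {}s12 : s1 <= s2 by case: s12.
have s2p : 0 < s2 by lra.
exists (ramp2 s1 s2 s2); split.
- by move=> t; apply: ramp2_ge0 => //; exact: ltW.
- exact: measurable_ramp2.
- move=> x t y /minkowski_pt3[x1 [t1 [y1' [x2 [t2 [y2 [S1x S2x _ -> ->]]]]]]].
  have [? ? ? ?] := box1 _ _ _ S1x; have [? ? ? ?] := box2 _ _ _ S2x.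
  apply: ramp2_le; rewrite ?(ltW s2p)//; first exact: (profile_above pr1) S1x.
  exact: (profile_above pr2) S2x.
- eexists; first by apply: integral_ramp2 => //; lra.
  have -> : s2 ^+ 2 / (2 * s2) = s2 / 2 by field; rewrite gt_eqF.
  lra.
Qed.

End geometry.

(** * Mixed volumes of bodies with a triangle *)

Section triangle_bodies.
Context (R : realType).
Local Notation mu := (@lebesgue_measure R).
Local Notation area N := ((mu \x mu)%E (planar N)).
Local Notation volume S := (((mu \x mu) \x mu)%E (spatial S)).
Implicit Types (S P Q : set 'rV[R]_3) (N : set 'rV[R]_2).

Lemma EFin_divl (k r : R) (x : \bar R) : 0 < k -> (k%:E * x = r%:E)%E -> x = (r / k)%:E.
Proof.
move=> k0; case: x => [x| |].
- by rewrite -EFinM => -[<-]; congr (_%:E); rewrite mulrC mulKf// gt_eqF.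
- by rewrite gt0_muley ?lte_fin.
- by rewrite gt0_muleNy ?lte_fin.
Qed.

Lemma normalized_vol2E N (r : R) : normalized_vol2 N = r%:E -> area N = (r / 2)%:E.
Proof. by move=> /EFin_divl; rewrite ltr0n; exact. Qed.

Lemma normalized_vol3E S (r : R) : normalized_vol3 S = r%:E -> volume S = (r / 6)%:E.
Proof. by move=> /EFin_divl; rewrite ltr0n; exact. Qed.

Lemma profile_ge (m : R) P Q N s d : 0 <= m -> lattice_polytope P ->
  compact Q -> compact N -> is_triangle m Q -> N = solid_shadow m P -> profile P s d ->
  (volume P + (area N + (m / 2 * d)%:E) <=
   volume (minkowski_sum P Q) + (m * (s / 2))%:E)%E.
Proof.
move=> m0 lP cQ cN QE NE pr.
have cP := lattice_polytope_compact lP; have vP := lattice_polytope_convex lP.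
have /andP[s0 sd] := profile_le pr.
rewrite -(@integral_ramp _ m s d) ?s0// -[X in (m / 2 * X)%:E]subr0.
have box := profile_box pr.
apply: (@sweep_ge _ m 0 d P _ N (ramp s)) => //.
- exact: le_trans sd.
- exact: compact_minkowski_sum.
- by move=> x t y /box[-> ->].
- by move=> t /(profile_ramp vP pr)[x [y [Pxy _]]]; exists x, y.
- by move=> x t y /box[].
- by move=> t; exact: slice_minkowski_sum_triangle.
- move=> t; rewrite NE; apply/seteqP; split => x /=; first by move=> /solid_shadowP.
  by move=> ?; apply/solid_shadowP.
- apply: measurable_patch => //.
  have -> : (fun t : R => 1 - t / s) = (fun t => 1 + (- s^-1) * t).
    by apply/funext => t; ring.
  exact: measurable_affine.
- by move=> t _; exact: ramp_ge0.
- by move=> t /(profile_ramp vP pr).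
Qed.

Lemma profile_sum_le (m : R) P1 P2 Q N1 N2 s1 d1 s2 d2 : 0 <= m ->
  lattice_polytope P1 -> lattice_polytope P2 ->
  compact Q -> compact N1 -> compact N2 -> is_triangle m Q ->
  N1 = solid_shadow m P1 -> N2 = solid_shadow m P2 ->
  profile P1 s1 d1 -> profile P2 s2 d2 ->
  s1 != 0 \/ s2 != 0 ->
  (volume (minkowski_sum (minkowski_sum P1 P2) Q) + (m * (s1 / 2 + s2 / 2 + 1))%:E <=
   volume (minkowski_sum P1 P2) +
     (area (minkowski_sum N1 N2) + (m / 2 * (d1 + d2))%:E))%E.
Proof.
move=> m0 lP1 lP2 cQ cN1 cN2 QE N1E N2E pr1 pr2 s12.
have cP1 := lattice_polytope_compact lP1; have vP1 := lattice_polytope_convex lP1.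
have cP2 := lattice_polytope_compact lP2; have vP2 := lattice_polytope_convex lP2.
have box1 := profile_box pr1; have box2 := profile_box pr2.
have /andP[s10 sd1] := profile_le pr1; have /andP[s20 sd2] := profile_le pr2.
have [psi [psi0 mpsi psi_le [J JE Jge]]] := profile_joint m0 pr1 pr2 s12.
apply: (@le_trans _ _ (volume (minkowski_sum (minkowski_sum P1 P2) Q) + (m * J)%:E)%E).
  by apply: leeD2l; rewrite lee_fin ler_wpM2l.
rewrite -JE -[X in (m / 2 * X)%:E]subr0.
apply: (@sweep_le _ m 0 (d1 + d2) _ _ _ psi) => //.
- by apply: addr_ge0; [exact: le_trans sd1|exact: le_trans sd2].
- exact: compact_minkowski_sum.
- exact: convex_minkowski_sum.
- by apply: compact_minkowski_sum => //; exact: compact_minkowski_sum.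
- exact: compact_minkowski_sum.
- move=> x t y /minkowski_pt3[x1 [t1 [y1 [x2 [t2 [y2 [/box1[? ? _ _] /box2[? ? _ _] _ -> _]]]]]]].
  by apply/andP; split; lra.
- move=> t /andP[t0 td].
  have [t1 [t2 [t1d t2d ->]]] : exists t1 t2, [/\ 0 <= t1 <= d1, 0 <= t2 <= d2 & t = t1 + t2].
    have [td1|d1t] := leP t d1.
      by exists t, 0; rewrite t0 td1 lexx (le_trans s20 sd2) addr0.
    exists d1, (t - d1); split; [|by apply/andP; split; lra|by rewrite addrC subrK].
    by rewrite lexx andbT (le_trans s10).
  have [x1 [y1 [P1x _]]] := profile_ramp vP1 pr1 t1d.
  have [x2 [y2 [P2x _]]] := profile_ramp vP2 pr2 t2d.
  by exists (x1 + x2), (y1 + y2); apply/minkowski_pt3; exists x1, t1, y1, x2, t2, y2.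
- move=> x t y /minkowski_pt3[x1 [t1 [y1 [x2 [t2 [y2 [/box1[_ _ ? _] /box2[_ _ ? _] _ _ ->]]]]]]].
  exact: addr_ge0.
- by move=> t; exact: slice_minkowski_sum_triangle.
- move=> t; rewrite N1E N2E -solid_shadow_minkowski_sum//.
  + by apply/seteqP; split => x /= ?; apply/solid_shadowP.
  + by move=> ? ? ? /box1[].
  + by move=> ? ? ? /box2[].
Qed.

(** Polarization turns the mixed volume into a combination of the volumes that
    the two previous lemmas bound; the terms in [s1], [s2], [d1], [d2] cancel and
    [- m] remains. *)
Lemma mixed_volume_drop (MV2 : 2.-tuple (set 'rV[R]_2) -> R)
    (MV3 : 3.-tuple (set 'rV[R]_3) -> R) (m : R) P1 P2 Q N1 N2 s1 d1 s2 d2 :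
  is_mixed_volume (@normalized_vol2 R) MV2 ->
  is_mixed_volume (@normalized_vol3 R) MV3 -> 0 <= m ->
  lattice_polytope P1 -> lattice_polytope P2 -> lattice_polytope Q ->
  lattice_polytope N1 -> lattice_polytope N2 -> is_triangle m Q ->
  N1 = solid_shadow m P1 -> N2 = solid_shadow m P2 ->
  profile P1 s1 d1 -> profile P2 s2 d2 ->
  s1 != 0 \/ s2 != 0 ->
  MV3 [tuple P1; P2; Q] <= MV2 [tuple N1; N2] - m.
Proof.
move=> hMV2 hMV3 m0 lP1 lP2 lQ lN1 lN2 QE N1E N2E pr1 pr2 s12.
have cQ := lattice_polytope_compact lQ.
have cN1 := lattice_polytope_compact lN1; have cN2 := lattice_polytope_compact lN2.
have [a [b [/normalized_vol2E aE /normalized_vol2E bE /normalized_vol2E abE]]] :=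
  mixed_area_polarization hMV2 lN1 lN2.
have [u [v [w [uv [uw [vw [
  [/normalized_vol3E uE /normalized_vol3E vE /normalized_vol3E wE]
  [/normalized_vol3E uvE /normalized_vol3E uwE /normalized_vol3E vwE]
  /normalized_vol3E uvwE]]]]]]] :=
  mixed_volume_polarization hMV3 lP1 lP2 lQ.
have w0 : w = 0.
  by move: wE; rewrite (volume_triangle cQ QE) => -[]; lra.
have := profile_sum_le m0 lP1 lP2 cQ cN1 cN2 QE N1E N2E pr1 pr2 s12.
have := profile_ge m0 lP1 cQ cN1 QE N1E pr1.
have := profile_ge m0 lP2 cQ cN2 QE N2E pr2.
rewrite uvwE uvE uwE vwE uE vE abE aE bE -!EFinD !lee_fin w0.
lra.
Qed.

End triangle_bodies.

(** * Coefficients and values of the lifted system *)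

Section algebra.
Context (R : realType).
Local Notation C := (complex R).

Definition mnm2 (i j : nat) : 'X_{1..2} := [multinom tnth [tuple i; j] k | k < 2].
Definition mnm3 (i j k : nat) : 'X_{1..3} := [multinom tnth [tuple i; j; k] l | l < 3].

Lemma mnm2_eta (a : 'X_{1..2}) : a = mnm2 (a 0) (a 1).
Proof. by apply/mnmP => -[[|[|i]] Hi]//; rewrite mnmE /=; congr (a _); apply/val_inj. Qed.

Lemma mnm3_eta (a : 'X_{1..3}) : a = mnm3 (a 0) (a 1) (a 2).
Proof. by apply/mnmP => -[[|[|[|i]]] Hi]//; rewrite mnmE /=; congr (a _); apply/val_inj. Qed.

Lemma mnm2E i j : (mnm2 i j 0 = i) * (mnm2 i j 1 = j).
Proof. by rewrite !mnmE. Qed.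

Lemma mnm3E i j k : (mnm3 i j k 0 = i) * (mnm3 i j k 1 = j) * (mnm3 i j k 2 = k).
Proof. by rewrite !mnmE. Qed.

Lemma mnm2_zero : mnm2 0 0 = 0%MM.
Proof. by apply/mnmP => -[[|[|i]] Hi]//; rewrite !mnmE. Qed.

Lemma mnmwiden_mnm2 i j : mnmwiden (mnm2 i j) = mnm3 i j 0.
Proof.
apply/mnmP => -[[|[|[|k]]] Hk]//.
- by rewrite (_ : Ordinal Hk = widen_ord (leqnSn 2) 0) ?mnmwiden_widen ?mnmE//; exact/val_inj.
- by rewrite (_ : Ordinal Hk = widen_ord (leqnSn 2) 1) ?mnmwiden_widen ?mnmE//; exact/val_inj.
- by rewrite (_ : Ordinal Hk = ord_max) ?mnmwiden_ordmax ?mnmE//; exact/val_inj.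
Qed.

Lemma mcoeff_mwiden (p : {mpoly C[2]}) i j k :
  (mwiden p)@_(mnm3 i j k) = if k == 0%N then p@_(mnm2 i j) else 0.
Proof.
case: eqP => [->|k0]; first by rewrite -mnmwiden_mnm2 mwiden_mnmwiden.
rewrite (mwidenE (leqnn _)) raddf_sum /= big1// => a _.
rewrite mcoeffZ mcoeffX; case: eqP => [E|]; last by rewrite mulr0.
have := mnmwiden_ordmax a; rewrite E => k0'; exfalso; apply: k0.
by rewrite -k0' mnmE.
Qed.

Lemma mcoeff_embed (q : {poly C}) (e i j k : nat) :
  ('X_(2 : 'I_3) ^+ e * embed_x1 q)@_(mnm3 i j k) =
  if (j == 0%N) && (k == e) then q`_i else 0.
Proof.
rewrite /embed_x1 (@horner_coef_wide _ (size q)) ?size_poly//.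
rewrite mulr_sumr raddf_sum /=.
have E l : ('X_(2 : 'I_3) ^+ e * ((map_poly (@mpolyC 3 C) q)`_l * 'X_0 ^+ l))@_(mnm3 i j k)
    = q`_l * [&& l == i, j == 0%N & k == e]%:R.
  rewrite coef_map /= mulrCA mcoeffCM !mpolyXn -mpolyXD mcoeffX; congr (_ * _%:R).
  congr (nat_of_bool _); apply/eqP/and3P => [E|[/eqP -> /eqP -> /eqP ->]].
    have := congr1 (fun a : 'X_{1..3} => a 0) E.
    have := congr1 (fun a : 'X_{1..3} => a 1) E.
    have := congr1 (fun a : 'X_{1..3} => a 2) E.
    rewrite /= !mnm3E !mnmDE !mulmnE !mnm1E /= => <- <- <-.
    by rewrite ?mul1n ?mul0n ?add0n ?addn0 !eqxx.
  by apply/mnmP => -[[|[|[|l']]] Hl]//; rewrite mnmDE !mulmnE !mnm1E mnmE -!val_eqE /=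
     ?mul1n ?mul0n ?add0n ?addn0.
rewrite (eq_bigr _ (fun (l : 'I_(size q)) _ => E l)) {E}.
case: ifPn => _; last by rewrite big1// => l _; rewrite andbF mulr0.
under eq_bigr do rewrite andbT.
have [iq|qi] := ltnP i (size q).
  rewrite (bigD1 (Ordinal iq))//= eqxx mulr1 big1 ?addr0// => l li.
  rewrite (_ : (l == i :> nat) = false) ?mulr0//; apply/negbTE.
  by apply: contraNneq li => li; apply/eqP/val_inj.
rewrite nth_default// big1// => l _; rewrite (_ : (l == i :> nat) = false) ?mulr0//.
by apply/negbTE; rewrite ltn_eqF// (leq_trans (ltn_ord l)).
Qed.

Lemma mcoeff_lift (q : {poly C}) (p : {mpoly C[2]}) i j k :
  ('X_(2 : 'I_3) * embed_x1 q + embed_x1 0 + mwiden p)@_(mnm3 i j k) =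
  (if (j == 0%N) && (k == 1%N) then q`_i else 0) +
  (if k == 0%N then p@_(mnm2 i j) else 0).
Proof.
rewrite !mcoeffD mcoeff_mwiden -[X in X * embed_x1 q]expr1 mcoeff_embed.
by rewrite /embed_x1 rmorph0 horner0 mcoeff0 addr0.
Qed.

Lemma mcoeff_graph (h : {poly C}) i j k :
  ('X_(2 : 'I_3) - embed_x1 h)@_(mnm3 i j k) =
  [&& i == 0%N, j == 0%N & k == 1%N]%:R -
  (if (j == 0%N) && (k == 0%N) then h`_i else 0).
Proof.
rewrite mcoeffB -[X in _ - X@__]mul1r -(expr0 'X_(2 : 'I_3)) mcoeff_embed mcoeffX.
congr (_%:R - _); congr (nat_of_bool _).
apply/eqP/and3P => [E|[/eqP -> /eqP -> /eqP ->]].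
  have := congr1 (fun a : 'X_{1..3} => a 0) E.
  have := congr1 (fun a : 'X_{1..3} => a 1) E.
  have := congr1 (fun a : 'X_{1..3} => a 2) E.
  by rewrite /= !mnm3E !mnm1E /= => <- <- <-.
by apply/mnmP => -[[|[|[|l']]] Hl]//; rewrite mnm1E mnmE -val_eqE.
Qed.

Lemma mcoeff_facial (u : 'rV[R]_2) (f : {mpoly C[2]}) b :
  (facial u f)@_b = if `[< face (newton f) u (expv R b) >] then f@_b else 0.
Proof.
rewrite /facial raddf_sum /=.
under eq_bigr do rewrite mcoeffZ mcoeffX.
have [bf|bf] := boolP (b \in msupp f); last first.
  rewrite (memN_msupp_eq0 bf) if_same big1_seq// => a /andP[_ af].
  by case: eqP => [E|]; [rewrite E (negbTE bf) in af|rewrite mulr0].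
rewrite big_mkcond (bigD1_seq b)//= eqxx mulr1 big1 ?addr0// => a /negbTE ->.
by rewrite mulr0 if_same.
Qed.

Lemma dotv_down (v : 'rV[R]_2) : dotv v (- e2 R) = - v 0 1.
Proof.
rewrite /dotv !big_ord_recl big_ord0 !mxE /= !mulr0n oppr0 mulr0 add0r addr0.
by rewrite mulr1n mulrN1; congr (- v _ _); apply/val_inj.
Qed.

Lemma newton_expv n (f : {mpoly C[n]}) a : f@_a != 0 -> newton f (expv R a).
Proof.
by move=> fa; apply: sub_convex_hull; exists a => //=; rewrite mcoeff_msupp.
Qed.

Lemma newton_min n (f : {mpoly C[n]}) (D : set 'rV[R]_n) :
  convex_set (D : set (convex_lmodType 'rV[R]_n)) ->
  (forall a, f@_a != 0 -> D (expv R a)) -> newton f `<=` D.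
Proof.
move=> vD fD; apply: convex_hull_min => // _ [a /= af <-].
by apply: fD; rewrite -mcoeff_msupp.
Qed.

Lemma newton_lattice n (f : {mpoly C[n]}) : f != 0 -> lattice_polytope (@newton R n f).
Proof.
move=> f0; exists [seq \row_i (a i)%:Z | a : 'X_{1..n} <- msupp f].
  by case E : (msupp f) => //; move: f0; rewrite -msupp_eq0 E.
rewrite /newton; congr convex_hull; apply/seteqP; split.
  move=> _ [a /= af <-]; exists (\row_i (a i)%:Z).
    by apply/mapP; exists a.
  by apply/rowP => i; rewrite !mxE.
move=> _ [_ /= /mapP[a af ->] <-]; exists a => //.
by apply/rowP => i; rewrite !mxE.
Qed.

(** The face in the direction of [- e2] is where the second exponent is least; it
    contains the origin, so the least value is 0. *)
Lemma mcoeff_bottom (f : {mpoly C[2]}) : (facial (- e2 R) f)@_0%MM != 0 ->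
  forall b, (facial (- e2 R) f)@_b = if b 1 == 0%N then f@_b else 0.
Proof.
rewrite mcoeff_facial; case: asboolP => [[N0 face0]|_]; last by rewrite eqxx.
move=> f0 b; rewrite mcoeff_facial.
have [fb|fb] := eqVneq f@_b 0; first by rewrite fb !if_same.
congr (if _ then _ else _); apply/asboolP/eqP => [[_]|b1].
  move=> /(_ _ N0); rewrite !dotv_down !mxE /= mnm0E oppr0 oppr_ge0.
  by rewrite lern0 => /eqP.
split; first exact: newton_expv.
move=> y /face0; rewrite !dotv_down !mxE b1.
by rewrite mnm0E.
Qed.

Lemma coef_univ_x1 (f : {mpoly C[2]}) j : (univ_x1 f)`_j = f@_(mnm2 j 0).
Proof.
rewrite /univ_x1 /mmap coef_sum.
have E (a : 'X_{1..2}) : (((f@_a)%:P * mmap1 (tnth [tuple 'X; 0]) a : {poly C}))`_j =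
    f@_a * (a == mnm2 j 0)%:R.
  rewrite coefCM; congr (_ * _); rewrite /mmap1 !big_ord_recl big_ord0 mulr1.
  rewrite [tnth _ _]/= [tnth _ _]/= [X in a X](_ : _ = 0); last exact/val_inj.
  rewrite [X in 0 ^+ a X](_ : _ = 1); last exact/val_inj.
  rewrite expr0n mulr_natr coefMn coefXn.
  rewrite (_ : (a == _) = (j == a 0) && (a 1 == 0%N)).
    by case: (j == _); case: (a 1 == _); rewrite ?mulr1n ?mulr0n.
  apply/eqP/andP => [->|[/eqP -> /eqP a1]]; first by rewrite !mnmE.
  by rewrite {1}(mnm2_eta a) a1.
under eq_bigr do rewrite E.
have [bf|bf] := boolP (mnm2 j 0 \in msupp f); last first.
  rewrite (memN_msupp_eq0 bf) big1_seq// => a /andP[_ af].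
  by case: eqP => [E'|]; [rewrite E' (negbTE bf) in af|rewrite mulr0].
rewrite (bigD1_seq (mnm2 j 0))//= eqxx mulr1 big1 ?addr0// => a /negbTE ->.
by rewrite mulr0.
Qed.

Lemma meval_embed_x1 (p : {poly C}) (v : 'I_3 -> C) : (embed_x1 p).@[v] = p.[v 0].
Proof.
rewrite /embed_x1 (@horner_coef_wide _ (size p)) ?size_poly// horner_coef.
rewrite raddf_sum /=; apply: eq_bigr => i _.
by rewrite coef_map /= mevalM mevalC rmorphXn /= mevalXU.
Qed.

Lemma meval_mwiden (p : {mpoly C[2]}) (a1 a2 b : C) :
  (mwiden p).@[tnth [tuple a1; a2; b]] = p.@[tnth [tuple a1; a2]].
Proof.
rewrite {1}[p]mpolyE (raddf_sum (@mwiden 2 C)) /= (raddf_sum (meval _)) /= mevalE.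
apply: eq_bigr => a _.
rewrite mwidenZ mevalZ mwidenX mevalX; congr (_ * _).
rewrite (mnm2_eta a) mnmwiden_mnm2 !big_ord_recl !big_ord0 !mnmE /=.
by rewrite expr0 !mulr1.
Qed.

Lemma meval_bottom (f : {mpoly C[2]}) (a1 a2 : C) :
  (forall b : 'X_{1..2}, b 1 != 0%N -> f@_b = 0) ->
  f.@[tnth [tuple a1; a2]] = (univ_x1 f).[a1].
Proof.
move=> f1; rewrite mevalE /univ_x1 /mmap horner_sum; apply: eq_big_seq => a af.
have a1E : a 1 = 0%N.
  by apply/eqP; move: af; rewrite mcoeff_msupp; apply: contraNT => /f1 ->.
rewrite hornerM hornerC; congr (_ * _).
rewrite /mmap1 !big_ord_recl !big_ord0 /= !mulr1.
have -> : lift ord0 ord0 = 1 :> 'I_2 by apply/val_inj.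
by rewrite a1E !expr0 !mulr1 hornerXn.
Qed.

End algebra.

(** * Newton polytopes of the lifted system *)

Section newton_polytopes.
Context (R : realType).
Local Notation C := (complex R).

Lemma expv_mnm2 i j : expv R (mnm2 i j) = pt2 i%:R j%:R.
Proof. by apply/rowP => -[[|[|k]] Hk]//; rewrite !mxE mnmE. Qed.

Lemma expv_mnm3 i j k : expv R (mnm3 i j k) = pt3 i%:R j%:R k%:R.
Proof. by apply/rowP => -[[|[|[|l]]] Hl]//; rewrite !mxE mnmE. Qed.

Lemma newton3_ind (F : {mpoly C[3]}) (D : R -> R -> R -> Prop) :
  (forall x y z x' y' z' t, 0 <= t -> t <= 1 -> D x y z -> D x' y' z' ->
    D (t * x + (1 - t) * x') (t * y + (1 - t) * y') (t * z + (1 - t) * z')) ->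
  (forall i j k, F@_(mnm3 i j k) != 0 -> D i%:R j%:R k%:R) ->
  forall x t y, newton F (pt3 x t y) -> D x t y.
Proof.
move=> vD FD x t y Nx.
have : [set v : 'rV[R]_3 | D (v 0 0) (v 0 1) (v 0 2)] (pt3 x t y).
  apply: newton_min Nx.
    apply/convex3P => a b c a' b' c' s s0 s1 /=; rewrite !mxE; exact: vD.
  move=> a; rewrite (mnm3_eta a) => /FD Da.
  by rewrite expv_mnm3 /= !mxE.
by rewrite /= !mxE.
Qed.

Lemma conv_ge0 (a b : R) (t : R) : 0 <= t -> t <= 1 -> 0 <= a -> 0 <= b ->
  0 <= t * a + (1 - t) * b.
Proof. by move=> ? ? ? ?; apply: addr_ge0; apply: mulr_ge0; lra. Qed.

Section triangle.
Variable h : {poly C}.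
Hypothesis h0 : h`_0 != 0.
Let m := (size h).-1.
Let g : {mpoly C[3]} := 'X_(2 : 'I_3) - embed_x1 h.

Let hm : h`_m != 0.
Proof.
rewrite -[h`_m]/(lead_coef h) lead_coef_eq0; apply: contraNneq h0 => ->.
by rewrite coef0.
Qed.

Lemma graph_neq0 : g != 0.
Proof.
apply: contraNneq h0 => g0; have := mcoeff_graph h 0 0 0.
by rewrite -/g g0 mcoeff0 /= sub0r => /esym/eqP; rewrite oppr_eq0.
Qed.

Lemma newton_graph : is_triangle m%:R (newton g : set 'rV[R]_3).
Proof.
move=> u w v; split.
  apply: (@newton3_ind _ (fun u w v =>
    [/\ w = 0, 0 <= v, v <= 1, 0 <= u & u <= m%:R * (1 - v)])).
    move=> x y z x' y' z' t t0 t1 [-> z0 z1 x0 xm] [-> z0' z1' x0' xm']; split.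
    - by rewrite !mulr0 addr0.
    - exact: conv_ge0.
    - nra.
    - exact: conv_ge0.
    - have -> : m%:R * (1 - (t * z + (1 - t) * z')) =
        t * (m%:R * (1 - z)) + (1 - t) * (m%:R * (1 - z')) by ring.
      by apply: lerD; apply: ler_wpM2l => //; lra.
  move=> i j k; rewrite mcoeff_graph.
  case E : [&& i == 0%N, j == 0%N & k == 1%N].
    move=> _; move/and3P : E => [/eqP-> /eqP-> /eqP->].
    by rewrite subrr mulr0 lexx ler01.
  rewrite sub0r oppr_eq0; case: ifPn => [/andP[/eqP -> /eqP ->] hi|]; last by rewrite eqxx.
  rewrite ler01 lexx ler0n subr0 mulr1 ler_nat; split => //.
  rewrite /m -ltnS prednK; first by apply: contraNltn hi => /leq_sizeP ->.
  by rewrite lt0n size_poly_eq0; apply: contraNneq h0 => ->; rewrite coef0.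
move=> [-> v0 v1 u0 um].
have vN := @convex_hull_convex R 3 [set expv R a | a in [set` msupp g]].
have N0 : newton g (pt3 0 0 0 : 'rV[R]_3).
  rewrite -[pt3 0 0 0]/(pt3 0%:R 0%:R 0%:R) -expv_mnm3; apply: newton_expv.
  by rewrite mcoeff_graph /= sub0r oppr_eq0.
have Nm : newton g (pt3 m%:R 0 0 : 'rV[R]_3).
  rewrite -[pt3 m%:R 0 0]/(pt3 m%:R 0%:R 0%:R) -expv_mnm3; apply: newton_expv.
  by rewrite mcoeff_graph /= !andbF sub0r oppr_eq0.
have Ny : newton g (pt3 0 0 1 : 'rV[R]_3).
  rewrite -[pt3 0 0 1]/(pt3 0%:R 0%:R 1%:R) -expv_mnm3; apply: newton_expv.
  by rewrite mcoeff_graph /= subr0 oner_eq0.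
have [v1E|v1'] := eqVneq v 1.
  have -> : u = 0 by apply/eqP; rewrite eq_le u0 andbT (le_trans um)// v1E subrr mulr0.
  by rewrite v1E.
have v10 : 0 < 1 - v by rewrite subr_gt0 lt_neqAle v1'.
have [m0|m0] := eqVneq (m%:R : R) 0.
  have -> : u = 0 by apply/eqP; rewrite eq_le u0 andbT (le_trans um)// m0 mul0r.
  move/convex3P : vN => /(_ _ _ _ _ _ _ v v0 v1 Ny N0).
  by rewrite !mulr0 !addr0 mulr1.
have m0' : 0 < (m%:R : R) by rewrite lt_neqAle eq_sym m0 ler0n.
move/convex3P : vN => vN.
have e0 : 0 <= u / (m%:R * (1 - v)) by rewrite divr_ge0// ltW// mulr_gt0.
have e1 : u / (m%:R * (1 - v)) <= 1 by rewrite ler_pdivrMr ?mul1r// mulr_gt0.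
have Nu := vN _ _ _ _ _ _ (u / (m%:R * (1 - v))) e0 e1 Nm N0.
have := vN _ _ _ _ _ _ v v0 v1 Ny Nu.
have -> : v * 0 + (1 - v) * (u / (m%:R * (1 - v)) * m%:R +
   (1 - u / (m%:R * (1 - v))) * 0) = u by field; rewrite m0 (gt_eqF v10).
by rewrite !mulr0 !addr0 !mulr0 !addr0 mulr1.
Qed.

End triangle.

Section lift.
Variables (f : {mpoly C[2]}) (q h : {poly C}).
Let fu := facial (- e2 R) f.
Let m := (size h).-1.
Let F : {mpoly C[3]} := 'X_(2 : 'I_3) * embed_x1 q + embed_x1 0 + mwiden (f - fu).
Hypothesis fu0 : fu@_0%MM != 0.
Hypothesis fuE : univ_x1 fu = q * h.

Let coef_qh j : (q * h)`_j = f@_(mnm2 j 0).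
Proof. by rewrite -fuE coef_univ_x1 mcoeff_bottom// mnm2E. Qed.

Let f00 : f@_(mnm2 0 0) != 0.
Proof. by move: fu0; rewrite mcoeff_bottom// mnm0E mnm2_zero. Qed.

Let qh0 : q`_0 != 0 /\ h`_0 != 0.
Proof.
have := coef_qh 0; rewrite coef0M => E.
by move: f00; rewrite -E mulf_eq0 negb_or => /andP.
Qed.

Let q_neq0 : q != 0.
Proof. by apply: contraNneq qh0.1 => ->; rewrite coef0. Qed.

Let h_neq0 : h != 0.
Proof. by apply: contraNneq qh0.2 => ->; rewrite coef0. Qed.

Let size_qh : (size (q * h)%R).-1 = ((size q).-1 + m)%N.
Proof.
rewrite size_mul// /m; move: q_neq0 h_neq0; rewrite -!size_poly_gt0.
by case: (size q) => // a; case: (size h) => // b _ _; rewrite addSn addnS.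
Qed.

Lemma mcoeff_lifted i j k : F@_(mnm3 i j k) =
  if j == 0%N then (if k == 1%N then q`_i else 0)
  else if k == 0%N then f@_(mnm2 i j) else 0.
Proof.
rewrite mcoeff_lift mcoeffB mcoeff_bottom// mnm2E.
by case: eqP => j0; rewrite /= ?addr0 ?subr0 ?add0r// subrr if_same addr0.
Qed.

Lemma lifted_neq0 : F != 0.
Proof.
apply: contraNneq qh0.1 => F0; have := mcoeff_lifted 0 0 1.
by rewrite F0 mcoeff0 /= => <-.
Qed.

Lemma base_neq0 : f != 0.
Proof. by apply: contraNneq f00 => ->; rewrite mcoeff0. Qed.

Lemma lift_meval (a1 a2 b : C) :
  F.@[tnth [tuple a1; a2; b]] =
  (b - h.[a1]) * q.[a1] + f.@[tnth [tuple a1; a2]].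
Proof.
rewrite /F !mevalD mevalM mevalXU !meval_embed_x1 horner0 addr0 meval_mwiden mevalB.
rewrite [in X in _ - X]meval_bottom; last first.
  by move=> c c1; rewrite mcoeff_bottom// (negbTE c1).
have -> : tnth [tuple a1; a2; b] 0 = a1 by [].
have -> : tnth [tuple a1; a2; b] 2 = b by [].
by rewrite fuE hornerM; ring.
Qed.

Let NP : set 'rV[R]_3 := newton F.
Let Nf : set 'rV[R]_2 := newton f.

Let vNP : convex_set (NP : set (convex_lmodType 'rV[R]_3)).
Proof. exact: convex_hull_convex. Qed.

Let vNf : convex_set (Nf : set (convex_lmodType 'rV[R]_2)).
Proof. exact: convex_hull_convex. Qed.

Let NP_top : NP (pt3 0 0 1).
Proof.
rewrite -[pt3 0 0 1]/(pt3 0%:R 0%:R 1%:R) -expv_mnm3; apply: newton_expv.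
by rewrite mcoeff_lifted /= qh0.1.
Qed.

Let NP_top_end : NP (pt3 (size q).-1%:R 0 1).
Proof.
rewrite -[pt3 _ 0 1]/(pt3 (size q).-1%:R 0%:R 1%:R) -expv_mnm3; apply: newton_expv.
by rewrite mcoeff_lifted /= -[q`__]/(lead_coef q) lead_coef_eq0.
Qed.

Let NP_floor i j : (0 < j)%N -> f@_(mnm2 i j) != 0 -> NP (pt3 i%:R j%:R 0).
Proof.
move=> j0 fij; rewrite -[pt3 _ _ 0]/(pt3 i%:R j%:R 0%:R) -expv_mnm3.
by apply: newton_expv; rewrite mcoeff_lifted /= gtn_eqF.
Qed.

Let Nf_bottom (x : R) : 0 <= x -> x <= ((size q).-1 + m)%:R -> Nf (pt2 x 0).
Proof.
move=> x0 xm; apply: (between_convex2 (x1 := 0) (x2 := ((size q).-1 + m)%:R)) => //.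
  rewrite -[pt2 0 0]/(pt2 0%:R 0%:R) -expv_mnm2; exact: newton_expv.
rewrite -[pt2 _ 0]/(pt2 ((size q).-1 + m)%:R 0%:R) -expv_mnm2.
apply: newton_expv; rewrite -coef_qh -size_qh -[_`__]/(lead_coef (q * h)).
by rewrite lead_coef_eq0 mulf_neq0.
Qed.

(** A term [x_1 ^ i * y] of the lift comes from the bottom edge of the Newton
    polygon of [f]; its exponent projects to [(i, 0)] and to [(i + m, 0)].  As [i]
    goes from 0 to the degree of [q], these points reach both ends of the bottom
    edge, whose length is the degree of [q] plus [m]. *)
Lemma newton_shadow : Nf = solid_shadow m%:R NP.
Proof.
apply/seteqP; split.
  apply: newton_min; first exact: convex_solid_shadow.
  move=> a; rewrite (mnm2_eta a) expv_mnm2; move: (a 0) (a 1) => {a} i j fij.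
  have [j0|j0] := posnP j; last first.
    by have [] := solid_shadow_pt (ler0n R m) (lexx 0) (NP_floor j0 fij).
  rewrite j0 in fij *; apply/solid_shadowP.
  exists (0, 1), ((size q).-1%:R, 1); split => //=.
  rewrite mulr1 -natrD ler_nat -size_qh -ltnS prednK; last first.
    by rewrite size_poly_gt0 mulf_neq0.
  by apply: contraNltn fij => /leq_sizeP ij; rewrite -coef_qh ij.
move=> v; rewrite (pt2_eta v); move: (v 0 0) (v 0 1) => {v} x t.
move=> /solid_shadowP[[a1 a2] [[b1 b2] /= [Na Nb ax xb]]].
have key x' t' y' : NP (pt3 x' t' y') -> Nf (pt2 x' t') /\ Nf (pt2 (x' + m%:R * y') t').
  apply: (@newton3_ind _ (fun x t y => Nf (pt2 x t) /\ Nf (pt2 (x + m%:R * y) t))).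
    move=> x1 y1 z1 x2 y2 z2 s s0 s1 [N1 N1'] [N2 N2']; split.
      by move/convex_rV2P : vNf; apply.
    have -> : s * x1 + (1 - s) * x2 + m%:R * (s * z1 + (1 - s) * z2) =
      s * (x1 + m%:R * z1) + (1 - s) * (x2 + m%:R * z2) by ring.
    by move/convex_rV2P : vNf; apply.
  move=> i j k; rewrite mcoeff_lifted; case: (j =P 0%N) => [->|j0].
    case: (k =P 1%N) => [->|]; last by rewrite eqxx.
    move=> qi; rewrite mulr1 -natrD.
    have iq : (i <= (size q).-1)%N.
      rewrite -ltnS prednK ?size_poly_gt0//.
      by apply: contraNltn qi => /leq_sizeP ->.
    by split; apply: Nf_bottom; rewrite ?ler0n// ler_nat ?leq_add2r//
      (leq_trans iq)// leq_addr.
  case: (k =P 0%N) => [->|]; last by rewrite eqxx.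
  move=> fij; rewrite mulr0 addr0 -expv_mnm2.
  by split; exact: newton_expv.
apply: (between_convex2 vNf _ _ ax xb); first by have [] := key _ _ _ Na.
by have [] := key _ _ _ Nb.
Qed.

(** [s] and [d] are the least and the largest positive exponent of [x_2] in [f],
    or both 0 if there is none. *)
Lemma newton_profile : exists s d, profile NP s d /\ (s = 0 -> f = fu).
Proof.
pose A := [seq a 1 | a : 'X_{1..2} <- msupp f & (0 < a 1%R)%N].
have AP i j : (0 < j)%N -> f@_(mnm2 i j) != 0 -> j \in A.
  move=> j0 fij; apply/mapP; exists (mnm2 i j); rewrite ?mnm2E//.
  by rewrite mem_filter mnm2E j0 mcoeff_msupp.
have AV j : j \in A -> (0 < j)%N /\ exists i, f@_(mnm2 i j) != 0.
  move=> /mapP[a]; rewrite mem_filter => /andP[a0 af] ->; split => //.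
  by exists (a 0); rewrite -mnm2_eta -mcoeff_msupp.
have [Anil|[j0 Aj0]] : A = [::] \/ exists j, j \in A.
  by case: (A) => [|j A']; [left|right; exists j; rewrite mem_head].
  have fj i j : (0 < j)%N -> f@_(mnm2 i j) = 0.
    by move=> j0; apply/eqP; apply/negP => /negP/(AP _ _ j0); rewrite Anil.
  exists 0, 0; split; last first.
    move=> _; apply/mpolyP => a; rewrite mcoeff_bottom//; case: eqP => // /eqP.
    by rewrite -lt0n {2}(mnm2_eta a) => /fj ->.
  have key x t y : NP (pt3 x t y) -> t = 0 /\ y = 1.
    apply: (@newton3_ind _ (fun _ t y => t = 0 /\ y = 1)).
      by move=> _ y1 z1 _ y2 z2 s s0 s1 [-> ->] [-> ->]; split; ring.
    move=> i j k; rewrite mcoeff_lifted; case: (j =P 0%N) => [->|/eqP].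
      by case: (k =P 1%N) => [->|]; [|rewrite eqxx].
    by rewrite -lt0n => /fj ->; rewrite if_same eqxx.
  split.
  - by move=> x t y /key[-> ->]; rewrite lexx ler01.
  - by move=> x t y /key[-> ->]; rewrite mul0r.
  - by exists 0.
  - by left; split => // x t y /key[].
have Abound j : j \in A -> (j <= \max_(j <- A) j)%N by move=> jA; exact: leq_bigmax_seq.
have [s sA smin] := ex_minnP (ex_intro (fun j => j \in A) j0 Aj0).
have [d dA dmax] := ex_maxnP (ex_intro (fun j => j \in A) j0 Aj0) Abound.
have [s0 [xs fs]] := AV _ sA; have [d0 [xd fd]] := AV _ dA.
exists s%:R, d%:R; split; last by move/eqP; rewrite pnatr_eq0 => /eqP sE; rewrite sE in s0.
have key x t y : NP (pt3 x t y) ->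
    [/\ 0 <= t, t <= d%:R, 0 <= y, y <= 1 & s%:R * (1 - y) <= t].
  apply: (@newton3_ind _ (fun _ t y =>
    [/\ 0 <= t, t <= d%:R, 0 <= y, y <= 1 & s%:R * (1 - y) <= t])).
    move=> _ y1 z1 _ y2 z2 r r0 r1 [? ? ? ? h1] [? ? ? ? h2]; split.
    - exact: conv_ge0.
    - nra.
    - exact: conv_ge0.
    - nra.
    - have -> : s%:R * (1 - (r * z1 + (1 - r) * z2)) =
        r * (s%:R * (1 - z1)) + (1 - r) * (s%:R * (1 - z2)) by ring.
      by apply: lerD; apply: ler_wpM2l => //; lra.
  move=> i j k; rewrite mcoeff_lifted; case: (j =P 0%N) => [->|/eqP].
    case: (k =P 1%N) => [->|]; last by rewrite eqxx.
    by rewrite subrr mulr0 !lexx ler01 ler0n.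
  rewrite -lt0n => j1; case: (k =P 0%N) => [->|]; last by rewrite eqxx.
  move=> /(AP _ _ j1) jA; rewrite subr0 mulr1 !ler_nat ler01 lexx ler0n.
  by split => //; [exact: dmax|exact: smin].
split.
- by move=> x t y /key[].
- by move=> x t y /key[].
- by exists 0.
- right; split.
  + by rewrite ler1n.
  + by rewrite ler_nat dmax.
  + by exists xs%:R; exact: NP_floor.
  + by exists xd%:R; exact: NP_floor.
Qed.

End lift.
End newton_polytopes.

Section lifting_system.
Context (R : realType).
Local Notation C := (complex R).

Lemma gcdp_quotient (h p p' : {poly C}) : h %= gcdp p p' ->
  [/\ p %% h = 0, p' %% h = 0, p = p %/ h * h & p' = p' %/ h * h].
Proof.
move=> hgcd.
have hp : h %| p by rewrite (eqp_dvdl _ hgcd) dvdp_gcdl.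
have hp' : h %| p' by rewrite (eqp_dvdl _ hgcd) dvdp_gcdr.
by rewrite !divpK//; split => //; exact/modp_eq0P.
Qed.

Variables (f1 f2 : {mpoly C[2]}) (q1 q2 h : {poly C}).
Let f1u := facial (- e2 R) f1.
Let f2u := facial (- e2 R) f2.
Let F1 : {mpoly C[3]} := 'X_(2 : 'I_3) * embed_x1 q1 + embed_x1 0 + mwiden (f1 - f1u).
Let F2 : {mpoly C[3]} := 'X_(2 : 'I_3) * embed_x1 q2 + embed_x1 0 + mwiden (f2 - f2u).
Let g : {mpoly C[3]} := 'X_(2 : 'I_3) - embed_x1 h.
Hypotheses (f1u0 : f1u@_0%MM != 0) (f2u0 : f2u@_0%MM != 0).
Hypotheses (f1uE : univ_x1 f1u = q1 * h) (f2uE : univ_x1 f2u = q2 * h).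

(** The witness for [y] is [h.[a1]], the only zero of [g] above [a1]. *)
Lemma lifting_is_lifting : is_lifting f1 f2 F1 F2 g.
Proof.
move=> a1 a2 _ _.
have E1 b : F1.@[tnth [tuple a1; a2; b]] = _ := lift_meval f1u0 f1uE a1 a2 b.
have E2 b : F2.@[tnth [tuple a1; a2; b]] = _ := lift_meval f2u0 f2uE a1 a2 b.
have Eg b : g.@[tnth [tuple a1; a2; b]] = b - h.[a1].
  by rewrite mevalB mevalXU meval_embed_x1.
split => [[f10 f20]|[b [F10 F20 g0]]].
  exists h.[a1]; split; [rewrite E1 f10|rewrite E2 f20|rewrite Eg];
    by rewrite subrr ?mul0r ?addr0 ?add0r.
have bh : b - h.[a1] = 0 by rewrite -Eg.
by split; [move: F10; rewrite E1|move: F20; rewrite E2];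
  rewrite bh mul0r add0r.
Qed.

Lemma lifting_mixed_volume (MV2 : 2.-tuple (set 'rV[R]_2) -> R)
    (MV3 : 3.-tuple (set 'rV[R]_3) -> R) :
  is_mixed_volume (@normalized_vol2 R) MV2 ->
  is_mixed_volume (@normalized_vol3 R) MV3 ->
  ~ (f1 = f1u /\ f2 = f2u) ->
  MV3 [tuple newton F1; newton F2; newton g] <=
  MV2 [tuple newton f1; newton f2] - (size h).-1%:R.
Proof.
move=> hMV2 hMV3 nf.
have h0 : h`_0 != 0.
  have : (univ_x1 f1u)`_0 != 0 by rewrite coef_univ_x1 mnm2_zero.
  by rewrite f1uE coef0M mulf_eq0 negb_or => /andP[].
have [s1 [d1 [pr1 s1f]]] := newton_profile f1u0 f1uE.
have [s2 [d2 [pr2 s2f]]] := newton_profile f2u0 f2uE.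
apply: (mixed_volume_drop hMV2 hMV3 (ler0n R _) _ _ _ _ _ (newton_graph h0)
  (newton_shadow f1u0 f1uE) (newton_shadow f2u0 f2uE) pr1 pr2).
- by apply: newton_lattice; exact: lifted_neq0 f1u0 f1uE.
- by apply: newton_lattice; exact: lifted_neq0 f2u0 f2uE.
- by apply: newton_lattice; exact: graph_neq0.
- by apply: newton_lattice; exact: base_neq0 f1u0.
- by apply: newton_lattice; exact: base_neq0 f2u0.
- have [s10|] := eqVneq s1 0; last by left.
  by right; apply/eqP => s20; apply: nf; split; [exact: s1f|exact: s2f].
Qed.

End lifting_system.

Theorem theorem5p1 (R : realType)
    (MV2 : 2.-tuple (set 'rV[R]_2) -> R)
    (MV3 : 3.-tuple (set 'rV[R]_3) -> R)
    (hMV2 : is_mixed_volume (@normalized_vol2 R) MV2)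
    (hMV3 : is_mixed_volume (@normalized_vol3 R) MV3)
    (f1 f2 : {mpoly (complex R)[2]}) (h : {poly complex R}) :
  let u := - e2 R in
  let f1u := facial u f1 in
  let f2u := facial u f2 in
  let p1 := univ_x1 f1u in
  let p2 := univ_x1 f2u in
  let m := (size h).-1 in
  let y : {mpoly (complex R)[3]} := 'X_(2 : 'I_3) in
  let q1 := p1 %/ h in
  let r1 := p1 %% h in
  let q2 := p2 %/ h in
  let r2 := p2 %% h in
  f1u@_0%MM != 0 ->
  f2u@_0%MM != 0 ->
  h %= gcdp p1 p2 ->
  (0 < m)%N ->
  exists F1 F2 g : {mpoly (complex R)[3]},
    [/\ [/\ F1 = y * embed_x1 q1 + embed_x1 r1 + mwiden (f1 - f1u),
            F2 = y * embed_x1 q2 + embed_x1 r2 + mwiden (f2 - f2u)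
          & g = y - embed_x1 h],
        r1 = 0 /\ r2 = 0,
        is_lifting f1 f2 F1 F2 g
      & (* the inequality is false when f1 and f2 both lie in C[x_1] *)
        ~ (f1 = f1u /\ f2 = f2u) ->
        MV3 [tuple newton F1; newton F2; newton g]
          <= MV2 [tuple newton f1; newton f2] - m%:R].
Proof.
move=> u f1u f2u p1 p2 m y q1 r1 q2 r2 f1u0 f2u0 hgcd _.
have [r10 r20 p1E p2E] := gcdp_quotient hgcd.
rewrite -/r1 in r10; rewrite -/r2 in r20; rewrite -/q1 in p1E; rewrite -/q2 in p2E.
rewrite r10 r20; eexists; eexists; eexists.
split; [split; reflexivity|by split| |].
  exact: lifting_is_lifting f1u0 f2u0 p1E p2E.
have H := lifting_mixed_volume f1u0 f2u0 p1E p2E hMV2 hMV3.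
exact H.
Qed.
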